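(* Suppose that $a_n\to\infty$, $\beta_n\to\beta_\infty$ as $n\to\infty$ with $|\beta_\infty|<1$, that $\sum_{n=0}^\infty a_n^{-1}=\infty$, and that for some $\delta>0$, as $n\to\infty$, $$\alpha_n'=O(n^{-1-\delta}),\quad \alpha_n''=O(n^{-2-\delta}),\quad \beta_n'=O(n^{-1-\delta}),\quad \beta_n''=O(n^{-2-\delta}),$$ $$k_n-1=O(n^{-1-\delta}),\quad k_n'=O(n^{-2-\delta}).$$ Then the relation $$\lim_{n\to\infty}\sqrt{a_n}\,q_n(z)P_n(z)=\pm\frac{i\,\Omega(z)}{2\sqrt{1-\beta_\infty^2}},\qquad \pm\operatorname{Im}z>0,$$ is true for all $z\in\mathbb C\setminus\mathbb R$, with convergence uniform on compact subsets of $\mathbb C\setminus\mathbb R$.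
   Context: $\mathbb Z_+=\{0,1,2,\dots\}$; $a_n>0$ and $b_n\in\mathbb R$ for $n\in\mathbb Z_+$, and $a_{-1}>0$ is an arbitrary fixed number. For a sequence $x_n$ put $x_n'=x_{n+1}-x_n$ and $x_n''=(x')_n'$. Notation: $$\alpha_n=\frac1{2\sqrt{a_{n-1}a_n}},\quad \beta_n=-\frac{b_n}{2\sqrt{a_{n-1}a_n}},\quad k_n=\frac{a_n}{\sqrt{a_{n-1}a_{n+1}}}.$$ The Jacobi equation is $a_{n-1}u_{n-1}+b_nu_n+a_nu_{n+1}=zu_n$, $n\in\mathbb Z_+$, for sequences $(u_n)_{n\ge-1}$. The polynomials $P_n(z)$ are its solution with $P_{-1}(z)=0$, $P_0(z)=1$. The Wronskian is $\{u,v\}=a_n(u_nv_{n+1}-u_{n+1}v_n)$, independent of $n\ge-1$ for solutions. The branch of $\sqrt{z^2-1}$ on $\mathbb C\setminus[-1,1]$ is analytic and positive for $z>1$; $\zeta(z)=z-\sqrt{z^2-1}$. Given $\rho_0>0$, fix $0<\varepsilon_0<1-|\beta_\infty|$ and choose $N_0=N_0(\rho_0)\ge1$ such that $|\alpha_nz+\beta_n-\beta_\infty|<\varepsilon_0$ for all $n\ge N_0$, $|z|<\rho_0$. For $|z|<\rho_0$, $\operatorname{Im}z\ne0$, put $q_n(z)=\prod_{m=N_0}^{n-1}\zeta(\alpha_mz+\beta_m)$; the Jost solution $f_n(z)$, $n\ge-1$, is the unique solution of the Jacobi equation with $f_n(z)=a_n^{-1/2}q_n(z)(1+o(1))$ as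 $n\to\infty$; $\Omega(z)=\{P(z),f(z)\}=-a_{-1}f_{-1}(z)$. Here $\rho_0$ is arbitrary with $|z|<\rho_0$ (respectively, with the compact set contained in $\{|z|<\rho_0\}$). *)

(* Defs.v *)
From HB Require Import structures.
From mathcomp Require Import all_boot all_order all_algebra.
From mathcomp Require Import complex ring lra.
From mathcomp Require Import all_classical all_reals all_analysis.

Set Implicit Arguments.
Unset Strict Implicit.
Unset Printing Implicit Defensive.

Import Order.TTheory GRing.Theory Num.Theory.
Import numFieldNormedType.Exports.

Local Open Scope classical_set_scope.
Local Open Scope ring_scope.
Local Open Scope complex_scope.

Lemma derivable_of_sqr (K : numFieldType) (s : K -> K) (z d : K) :
  (forall x, s x ^+ 2 = x ^+ 2 - 1) -> s z != 0 -> 0 < d ->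
  (forall h, `|h| <= d -> d <= `|s (h + z) + s z|) ->
  derivable (s : K^o -> K^o) z 1.
Proof.
move=> s2 sz0 eta20 low.
have F0 : Filter (nbhs (0 : K)) by exact: nbhs_filter.
have cvg0 : h @[h --> (0 : K)] --> (0 : K) by exact: cvg_id.
have dnear : \forall h \near (0 : K), `|h| <= d.
  have /(@cvgrPdist_le _ _ _ _ F0)/(_ _ eta20) := cvg0.
  by apply: filterS => h; rewrite sub0r normrN.
have scont : (fun h : K => s (h + z)) h @[h --> (0 : K)]
    --> (s z).
  apply/(@cvgrPdist_lt _ _ _ _ F0) => e e0.
  have sqr_cvg : (fun h : K => (h + z) * (h + z)) h @[h --> (0 : K)]
      --> ((0 + z) * (0 + z)).
    by apply: cvgM; apply: cvgD; [exact: cvg_id|exact: cvg_cst|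
                                  exact: cvg_id|exact: cvg_cst].
  have eeta : 0 < e * d by rewrite mulr_gt0.
  move/(@cvgrPdist_lt _ _ _ _ F0) : sqr_cvg => /(_ _ eeta) sqr_near.
  near=> h.
  have hh : `|h| <= d by near: h.
  rewrite -(ltr_pM2r eta20).
  apply: (@le_lt_trans _ _ (`|s z - s (h + z)| * `|s (h + z) + s z|)).
    by rewrite ler_wpM2l // low.
  rewrite -normrM [X in `|_ * X|]addrC -subr_sqr !s2 opprB addrA subrK.
  rewrite -[z in z ^+ 2 - _]add0r !expr2.
  by near: h.
apply/cvg_ex; exists ((0 + 2 * z) / (s z + s z)).
have : (fun h : K => (h + 2 * z) / (s (h + z) + s z)) h
    @[h --> (0 : K)^'] --> ((0 + 2 * z) / (s z + s z)).
  apply: cvgM.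
    apply: cvgD; last exact: cvg_cst.
    by apply: cvg_within_filter; exact: cvg_id.
  apply: cvgV; first by rewrite -mulr2n mulrn_eq0.
  apply: cvgD; last exact: cvg_cst.
  by apply: cvg_within_filter; exact: scont.
apply: cvg_trans; apply: near_eq_cvg.
near=> h.
have hh : `|h| <= d by near: h; apply: cvg_within.
have h0 : h != 0 by near: h; exact: nbhs_dnbhs_neq.
have d0 : s (h + z) + s z != 0.
  by rewrite -normr_gt0 (lt_le_trans eta20) ?low.
rewrite /= /shift /= /GRing.scale /= mulr1.
apply: (mulfI h0); rewrite mulVKf // mulrCA.
apply: (mulIf d0); rewrite mulrA divfK // -subr_sqr !s2.
ring.
Unshelve. all: by end_near. Qed.

Section Defs.
Context {R : realType}.
Local Notation C := (R[i]).

(* Sequences indexed by n >= -1 are functions on int whose values below -1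
   are never used; sequences indexed by n >= 0 are functions on nat, and
   n : nat is silently coerced to int where needed. *)

Definition seq_diff (x : nat -> R) (n : nat) : R := x n.+1 - x n.

Definition alpha (a : int -> R) (n : nat) : R :=
  (2 * Num.sqrt (a (n%:Z - 1) * a n))^-1.

Definition beta (a : int -> R) (b : nat -> R) (n : nat) : R :=
  - b n / (2 * Num.sqrt (a (n%:Z - 1) * a n)).

Definition kratio (a : int -> R) (n : nat) : R :=
  a n / Num.sqrt (a (n%:Z - 1) * a n.+1).

Definition bigO_pow (x : nat -> R) (s : R) : Prop :=
  (x : nat -> R^o) =O_\oo (fun n : nat => (n%:R `^ s : R^o)).

Definition jacobi_solution (a : int -> R) (b : nat -> R) (z : C)
    (u : int -> C) : Prop :=
  forall n : nat,
    (a (n%:Z - 1))%:C * u (n%:Z - 1) + (b n)%:C * u n + (a n)%:C * u n.+1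
    = z * u n.

(* The pair (P_{n-1}(z), P_n(z)). *)
Fixpoint orthopoly_pair (a : int -> R) (b : nat -> R) (z : C) (n : nat)
    : C * C :=
  if n is m.+1 then
    let: (p0, p1) := orthopoly_pair a b z m in
    (p1, ((z - (b m)%:C) * p1 - (a (m%:Z - 1))%:C * p0) / (a m)%:C)
  else (0, 1).

Definition orthopoly (a : int -> R) (b : nat -> R) (z : C) (n : int) : C :=
  if n is Posz m then (orthopoly_pair a b z m).2 else 0.

Definition wronskian (a : int -> R) (u v : int -> C) (n : int) : C :=
  (a n)%:C * (u n * v (n + 1) - u (n + 1) * v n).

(* The Wronskian of two solutions does not depend on n >= -1
   (lemma wronskian_const), so it is taken at n = -1. *)
Definition Omega (a : int -> R) (b : nat -> R) (f : C -> int -> C) (z : C)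
    : C :=
  wronskian a (orthopoly a b z) (f z) (-1).

Definition cut : set C := [set x%:C | x in `[(-1 : R), 1]].

(* Analyticity on the open set ~` cut is complex differentiability there. *)
Definition is_sqrt_branch (s : C -> C) : Prop :=
  [/\ forall z, ~ cut z -> derivable (s : C^o -> C^o) z 1,
      forall z, ~ cut z -> s z ^+ 2 = z ^+ 2 - 1
    & forall x : R, 1 < x -> 0 < s x%:C].

Definition zeta (s : C -> C) (z : C) : C := z - s z.

Definition qprod (s : C -> C) (a : int -> R) (b : nat -> R) (N0 : nat)
    (z : C) (n : nat) : C :=
  \prod_(N0 <= m < n) zeta s ((alpha a m)%:C * z + (beta a b m)%:C).

Definition jost_solution (s : C -> C) (a : int -> R) (b : nat -> R)
    (N0 : nat) (z : C) (u : int -> C) : Prop :=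
  jacobi_solution a b z u /\
  exists2 e : nat -> C, (e n : C^o) @[n --> \oo] --> (0 : C^o) &
    forall n : nat,
      u n = ((Num.sqrt (a n))^-1)%:C * qprod s a b N0 z n * (1 + e n).

Lemma orthopoly_jacobi (a : int -> R) (b : nat -> R) (z : C) : (forall n : nat, 0 < a n) ->
  jacobi_solution a b z (orthopoly a b z).
Proof.
move=> a_gt0 n.
have a0 : (a n)%:C != 0 by rewrite fmorph_eq0 gt_eqF.
have -> : orthopoly a b z (n%:Z - 1) = (orthopoly_pair a b z n).1.
  case: n {a0} => [//|n]; rewrite -addn1 PoszD addrK addn1 /=.
  by case: (orthopoly_pair a b z n).
rewrite /=; case: (orthopoly_pair a b z n) => p0 p1 /=.
rewrite [_%:C * (_ / _)]mulrC divfK // mulrBl.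
by rewrite addrC addrA subrK subrK.
Qed.

Lemma wronskian_const (a : int -> R) (b : nat -> R) (z : C)
    (u v : int -> C) (n : nat) :
  jacobi_solution a b z u -> jacobi_solution a b z v ->
  wronskian a u v n = wronskian a u v (-1).
Proof.
move=> hu hv.
suff step m : wronskian a u v m%:Z = wronskian a u v (m%:Z - 1).
  elim: n => [|n ih]; first by rewrite step.
  by rewrite step -addn1 PoszD addrK.
rewrite /wronskian subrK.
have -> : m%:Z + 1 = m.+1 by rewrite -addn1.
have eu : (a m)%:C * u m.+1
    = (z - (b m)%:C) * u m - (a (m%:Z - 1))%:C * u (m%:Z - 1).
  by rewrite mulrBl -(hu m); ring.
have ev : (a m)%:C * v m.+1
    = (z - (b m)%:C) * v m - (a (m%:Z - 1))%:C * v (m%:Z - 1).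
  by rewrite mulrBl -(hv m); ring.
have -> : (a m)%:C * (u m * v m.+1 - u m.+1 * v m)
   = u m * ((a m)%:C * v m.+1) - ((a m)%:C * u m.+1) * v m by ring.
by rewrite eu ev; ring.
Qed.

Lemma OmegaE (a : int -> R) (b : nat -> R) (f : C -> int -> C) (z : C) :
  Omega a b f z = - ((a (-1))%:C * f z (-1)).
Proof. by rewrite /Omega /wronskian /= mul0r mul1r sub0r mulrN. Qed.

Lemma is_sqrt_branch_exists : exists s, is_sqrt_branch s.
Proof.
pose t (z : C) : C := sqrtC (z ^+ 2 - 1).
pose s (z : C) : C := if `|z - t z| < `|z + t z| then t z else - t z.
have s2 z : s z ^+ 2 = z ^+ 2 - 1.
  by rewrite /s; case: ifP => _; rewrite ?sqrrN sqrtCK.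
have norm1 z : `|z - s z| * `|z + s z| = 1.
  by rewrite -normrM -subr_sqr s2 subKr normr1.
have les z : `|z - s z| <= `|z + s z|.
  rewrite /s; case: ifPn => [/ltW//|]; rewrite opprK.
  by rewrite -real_leNgt ?normr_real.
have ge1 z : 1 <= `|z + s z|.
  rewrite real_leNgt ?normr_real ?real1 //; apply/negP => lt1.
  have := norm1 z; apply/eqP; rewrite lt_eqF//.
  have lt1' : `|z - s z| < 1 by apply: le_lt_trans lt1; exact: les.
  by rewrite mulr_ilt1 ?normr_ge0.
have lt1 z : ~ cut z -> `|z - s z| < 1.
  move=> ncut; rewrite real_ltNge ?normr_real ?real1 //; apply/negP => ge1'.
  have e1 : `|z - s z| = 1.
    apply/eqP; rewrite eq_le ge1' andbT -[leRHS](norm1 z).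
    by rewrite ler_peMr.
  apply: ncut.
  have ej : z + s z = (z - s z)^*%C.
    have nz : z - s z != 0 by rewrite -normr_eq0 e1 oner_eq0.
    apply: (mulfI nz); rewrite -sqr_normc e1 expr1n -subr_sqr s2.
    by rewrite subKr.
  have zE : z = (complex.Re (z - s z))%:C.
    apply: (@mulfI _ (2 : C)); first by rewrite pnatr_eq0.
    have -> : 2 * z = (z - s z) + (z + s z) by ring.
    rewrite ej; case: (z - s z) => x y; apply/eqP; rewrite eq_complex /=.
    by apply/andP; split; apply/eqP; ring.
  exists (complex.Re (z - s z)); last by rewrite -zE.
  have : `|complex.Re (z - s z)|%:C <= 1 by rewrite -e1 normc_ge_Re.
  by rewrite lecR ler_norml /= in_itv.
exists s; split=> // [z ncut|x x1].
- pose eta := 1 - `|z - s z|.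
  have eta0 : 0 < eta by rewrite subr_gt0 lt1.
  have low h : `|h| <= eta / 2 -> eta / 2 <= `|s (h + z) + s z|.
    move=> hh; have := ge1 (h + z).
    have -> : h + z + s (h + z) = (s (h + z) + s z) + (h + (z - s z)) by ring.
    move=> /le_trans/(_ (ler_normD _ _)) H.
    have H2 := ler_normD h (z - s z).
    rewrite -(lerD2r (`|h| + `|z - s z|)).
    apply: le_trans (le_trans H _); last by rewrite lerD2l.
    by rewrite addrA -lerBrDr -/eta [leRHS](splitr eta) lerD2l.
  have sz0 : s z != 0.
    apply/eqP => sz0; have := lt1 _ ncut; rewrite sz0 subr0.
    by have := norm1 z; rewrite sz0 subr0 addr0 -expr2 => /eqP;
      rewrite sqrp_eq1 // => /eqP ->; rewrite ltxx.
  exact: (derivable_of_sqr s2 sz0 (divr_gt0 eta0 _) low).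
- have x0 : 0 < x%:C by rewrite ltcR (lt_trans _ x1).
  have t0 : 0 < t x%:C.
    rewrite sqrtC_gt0 -rmorphXn -(rmorph1 (real_complex R)) -rmorphB ltcR.
    by rewrite subr_gt0 exprn_egt1.
  rewrite /s ifT // (gtr0_norm (addr_gt0 x0 t0)) real_ltr_norml.
    by rewrite opprD ltrD2r ltrD2l !gtrN.
  by rewrite rpredB // gtr0_real.
Qed.

End Defs.

(* Main.v *)
(* Put F_n = sqrt(a_n) q_n P_n and zeta_n = zeta(alpha_n z + beta_n).  The Jacobi
   equation becomes
     k_{n+1} F_{n+2} = (1 + zeta_{n+1}^2) F_{n+1} - zeta_{n+1} zeta_n F_n,
   and X_n = F_{n+1} - zeta_n^2 F_n, Y_n = F_{n+1} - F_n diagonalize it up to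
   errors of size h_n (|X_n| + |Y_n|) with h summable: X_{n+1} is close to X_n and
   Y_{n+1} to zeta_{n+1}^2 Y_n.  Hence X is Cauchy, and Y tends to 0 since
   |zeta_n| (1 + |Im z| alpha_n) <= 1 and the alpha_n have infinite sum; both
   statements are uniform for |z| < rho_0, |Im z| >= eta, so F is uniformly Cauchy
   there.  Its pointwise limit is read off the Wronskian of P and the Jost
   solution, because F_{n+1} - F_n tends to 0 and a_{n+1} / a_n tends to 1. *)

Require Import Defs.
From HB Require Import structures.
From mathcomp Require Import all_boot all_order all_algebra.
From mathcomp Require Import complex ring lra.
From mathcomp Require Import all_classical all_reals all_analysis.

Set Implicit Arguments.
Unset Strict Implicit.
Unset Printing Implicit Defensive.

Import Order.TTheory GRing.Theory Num.Theory.
Import numFieldNormedType.Exports.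
Import Normc.

Local Open Scope classical_set_scope.
Local Open Scope ring_scope.
Local Open Scope complex_scope.

(** * Sequences with absolutely summable tails *)

Section RealSequences.
Context {R : realType}.
Implicit Types (h x y t : nat -> R).

(** The limiting recurrence has characteristic roots 1 and zeta^2; X annihilates the mode of zeta^2
    and Y the constant mode. The obstacle is that alpha_n z + beta_n tends to beta_inf, a point of
    the cut, so |zeta_n| tends to 1 and Y has no geometric decay: only the divergence of the sum of
    the alpha_n, inherited from Carleman's condition, damps it. The roots stay apart because zeta^2
    = 1 only at the branch points 1 and -1, while |beta_inf| < 1; so F is recovered from X_n - Y_n =
    (1 - zeta_n^2) F_n. The number h_n dominates |zeta_(n+1) - zeta_n| and |k_(n+1) - 1|. The Jost
    solution serves only to identify the pointwise limit, so an o(1) given separately for each z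
    suffices; uniformity comes from the Cauchy estimate. Summability is stated as the Cauchy
    criterion below because each estimate consumes finite sums over late indices. *)

Definition vanishing_tails h := forall e, 0 < e ->
  exists N, forall m n, (N <= m)%N -> \sum_(m <= j < n) `|h j| <= e.

Lemma vanishing_tails_le x h N : vanishing_tails h ->
  (forall n, (N <= n)%N -> `|x n| <= `|h n|) -> vanishing_tails x.
Proof.
move=> hh xh e e0; have [M hM] := hh e e0.
exists (maxn N M) => m n; rewrite geq_max => /andP[Nm Mm].
apply: le_trans (hM m n Mm); apply: ler_sum_nat => j /andP[mj _].
exact/xh/(leq_trans Nm).
Qed.

Lemma vanishing_tailsD x y :
  vanishing_tails x -> vanishing_tails y -> vanishing_tails (fun n => x n + y n).
Proof.
move=> hx hy e e0; have e20 : 0 < e / 2 by rewrite divr_gt0.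
have [N1 h1] := hx _ e20; have [N2 h2] := hy _ e20.
exists (maxn N1 N2) => m n; rewrite geq_max => /andP[m1 m2].
rewrite [leRHS]splitr; apply: le_trans (lerD (h1 m n m1) (h2 m n m2)).
by rewrite -big_split /=; apply: ler_sum => j _; exact: ler_normD.
Qed.

Lemma vanishing_tailsZ c x :
  vanishing_tails x -> vanishing_tails (fun n => c * x n).
Proof.
move=> hx e e0; have c0 : 0 < `|c| + 1 by rewrite ltr_wpDl.
have [N hN] := hx _ (divr_gt0 e0 c0).
exists N => m n Nm; have := hN m n Nm; rewrite ler_pdivlMr // => /(le_trans _); apply.
rewrite mulrC mulr_sumr; apply: ler_sum => j _.
by rewrite normrM ler_wpM2r // lerDl.
Qed.

Lemma vanishing_tails_norm x :
  vanishing_tails x -> vanishing_tails (fun n => `|x n|).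
Proof.
by move=> hx; apply: (vanishing_tails_le (N := 0) hx) => n _; rewrite normr_id.
Qed.

Lemma vanishing_tails_shift x :
  vanishing_tails x -> vanishing_tails (fun n => x n.+1).
Proof.
move=> hx e e0; have [N hN] := hx _ e0.
exists N => m n Nm; rewrite -(big_add1 _ _ _ n.+1 xpredT (fun j => `|x j|)).
exact/hN/leqW.
Qed.

Lemma vanishing_tails_telescope t :
  (forall e, 0 < e -> exists N, forall n, (N <= n)%N -> `|t n| <= e) ->
  (forall n, (0 < n)%N -> t n.+1 <= t n) -> vanishing_tails (fun n => t n - t n.+1).
Proof.
move=> t0 tdec e e0.
have [N hN] := t0 _ (divr_gt0 e0 (ltr0Sn _ 1)).
(* The shift keeps j positive, as [t] decreases only from 1 on: the intended [t], the power n^(-d),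
   is 0 at n = 0 by the convention for [powR]. *)
exists N.+1 => m n Nm.
have [mn|nm] := leqP m n; last by rewrite big_geq ?ltW // ltnW.
rewrite (eq_big_nat _ _ (F2 := fun j => - (t j.+1 - t j))); last first.
  move=> j /andP[mj _]; rewrite ger0_norm ?opprB// subr_ge0 tdec //.
  by apply: leq_trans mj; apply: leq_ltn_trans Nm.
rewrite sumrN telescope_sumr // opprB [leRHS]splitr.
have := hN m (ltnW Nm); have := hN n (leq_trans (ltnW Nm) mn).
by rewrite !ler_norml; lra.
Qed.

(** A discrete substitute for integrating x^(-1-d): the quotient of the two powers is exp(d (ln(n+1)
    - ln n)), and exp x >= 1 + x together with ln(1 - 1/(n+1)) <= -1/(n+1) gives the bound. *)
Lemma powR_decrement (d : R) n : 0 < d -> (0 < n)%N ->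
  d * n.+1%:R `^ (- 1 - d) <= n%:R `^ (- d) - n.+1%:R `^ (- d).
Proof.
move=> d0 n0; have n0R : 0 < (n%:R : R) by rewrite ltr0n.
have n1R : 0 < (n.+1%:R : R) by rewrite ltr0n.
set p := n.+1%:R `^ (- d).
have p0 : 0 < p by rewrite powR_gt0.
have -> : n.+1%:R `^ (- 1 - d) = p / n.+1%:R.
  rewrite [- 1 - d]addrC powRD ?(gt_eqF n1R) ?implybT//.
  by rewrite -/p powR_inv1 // ltW.
have -> : n%:R `^ (- d) = p * expR (d * (ln n.+1%:R - ln n%:R)).
  by rewrite /p /powR !gt_eqF // -expRD; congr expR; ring.
have H1 : n.+1%:R^-1 <= ln n.+1%:R - ln n%:R :> R.
  have n1' : 1 < n.+1%:R :> R by rewrite ltr1n ltnS.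
  have : ln (1 + - n.+1%:R^-1) <= - n.+1%:R^-1 :> R.
    by apply: le_ln1Dx; rewrite ltrN2 invf_lt1 // .
  have -> : 1 + - n.+1%:R^-1 = n%:R / n.+1%:R :> R.
    by field; rewrite gt_eqF.
  by rewrite ln_div ?posrE // -[leLHS]opprB lerN2.
have H2 : 1 + d * n.+1%:R^-1 <= expR (d * (ln n.+1%:R - ln n%:R)).
  apply: le_trans (expR_ge1Dx _); rewrite lerD2l ler_pM2l //.
suff : p * (1 + d * n.+1%:R^-1) <= p * expR (d * (ln n.+1%:R - ln n%:R)).
  by rewrite mulrDr mulr1 [d * (p / _)]mulrCA lerBrDl.
by rewrite ler_pM2l.
Qed.

Lemma vanishing_tails_powR (d : R) :
  0 < d -> vanishing_tails (fun n => n%:R `^ (- 1 - d)).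
Proof.
move=> d0.
pose t n := n%:R `^ (- d) : R.
have tt : vanishing_tails (fun n => d^-1 * (t n - t n.+1)).
  apply/vanishing_tailsZ/vanishing_tails_telescope => [e e0|n n0]; last first.
    rewrite -subr_ge0; apply: le_trans (powR_decrement d0 n0).
    by rewrite mulr_ge0 ?powR_ge0 // ltW.
  pose x := e^-1 `^ d^-1; have x0 : 0 < x by rewrite powR_gt0 // invr_gt0.
  exists (Num.bound x) => n xn; have xn' : x <= n%:R.
    by rewrite (le_trans (ltW (archi_boundP (ltW x0)))) // ler_nat.
  have n0 : 0 < (n%:R : R) := lt_le_trans x0 xn'.
  rewrite ger0_norm ?powR_ge0 // /t powRN invf_ple ?posrE ?powR_gt0 //.
  have -> : e^-1 = x `^ d.
    by rewrite /x -powRrM mulVf ?gt_eqF // powRr1 // invr_ge0 ltW.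
  by apply: ge0_ler_powR => //; rewrite ?nnegrE ltW.
have dec n : (0 < n)%N -> n.+1%:R `^ (- 1 - d) <= d^-1 * (t n - t n.+1).
  by move=> n0; rewrite ler_pdivlMl // powR_decrement.
(* The decrement from j to j+1 dominates the term at j+1, so the sum is shifted by one; starting at
   N+2 keeps the shifted index positive. *)
move=> e e0; have [N hN] := tt e e0; exists N.+2 => [[//|m]] n Nm.
case: n => [|n]; first by rewrite big_geq ?ltW.
rewrite big_add1 /=; apply: le_trans (hN m n (ltnW Nm)).
apply: ler_sum_nat => j /andP[mj _].
have j0 : (0 < j)%N by apply: leq_trans mj; case: m Nm.
rewrite ger0_norm ?powR_ge0 //; apply: le_trans (dec _ j0) _.
exact: ler_norm.
Qed.

Lemma bigO_pow_vanishing_tails x (d : R) :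
  0 < d -> bigO_pow x (- 1 - d) -> vanishing_tails x.
Proof.
move=> d0 /eqO_exP[k k0 /= [N _ hN]].
apply: (vanishing_tails_le (N := N) (vanishing_tailsZ k (vanishing_tails_powR d0))).
by move=> n Nn; have := hN n Nn; rewrite normrM (gtr0_norm k0).
Qed.

Lemma vanishing_tails_le1 h e : vanishing_tails h -> 0 < e ->
  exists N, forall n, (N <= n)%N -> `|h n| <= e.
Proof.
move=> hh e0; have [N hN] := hh e e0; exists N => n Nn.
by have := hN n n.+1 Nn; rewrite big_nat1.
Qed.

(** The inequality ln y <= y - 1, taken at x and at 1/x, bounds ln x on both sides; x >= 1/2 gives
    the factor 2. *)
Lemma norm_ln_le (x : R) : `|x - 1| <= 1 / 2 -> `|ln x| <= 2 * `|x - 1|.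
Proof.
move=> x1; have [x1a x1b] : - (1 / 2) <= x - 1 /\ x - 1 <= 1 / 2.
  by move: x1; rewrite ler_norml => /andP[].
have x0 : 0 < x by lra.
have up (y : R) : 0 < y -> ln y <= y - 1.
  move=> y0; have : ln (1 + (y - 1)) <= y - 1 by apply: le_ln1Dx; lra.
  by rewrite [1 + _]addrC subrK.
have u1 := up _ x0.
have : ln x^-1 <= x^-1 - 1 by apply: up; rewrite invr_gt0.
rewrite lnV ?posrE // => u2.
have : x^-1 - 1 <= 2 * `|x - 1|.
  have -> : x^-1 - 1 = (1 - x) / x by field; rewrite gt_eqF.
  rewrite ler_pdivrMr // -subr_ge0.
  have := ler_norm (1 - x); rewrite distrC; have := normr_ge0 (x - 1).
  by nra.
have := ler_norm (x - 1); have := normr_ge0 (x - 1).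
by rewrite ler_norml; lra.
Qed.

End RealSequences.

(** * Coefficient ratios *)

Section Coefficients.
Context {R : realType}.
Implicit Type a : int -> R.

Lemma vanishing_tails_cauchy (x : nat -> R) :
  vanishing_tails (fun n => x n.+1 - x n) -> forall e, 0 < e ->
  exists N, forall m n, (N <= m)%N -> (N <= n)%N -> `|x m - x n| <= e.
Proof.
move=> hx e e0; have [N hN] := hx e e0; exists N.
suff le m n : (N <= m <= n)%N -> `|x n - x m| <= e.
  move=> m n Nm Nn; have [mn|/ltnW nm] := leqP m n.
    by rewrite distrC le // Nm.
  by rewrite le // Nn.
move=> /andP[Nm mn]; apply: le_trans (hN m n Nm).
by rewrite -telescope_sumr //; exact: ler_norm_sum.
Qed.

(* The increments of [ln (a n.+1 / a n)] are [- 2 ln (kratio a n.+1)], hence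
   summable; a nonzero limit would make [a] geometrically growing, against
   Carleman's condition, or bounded. *)
Lemma ratio_cvg1 a : (forall n : int, -1 <= n -> 0 < a n) ->
  (fun n : nat => a n) @ \oo --> +oo ->
  series (fun n : nat => (a n)^-1) @ \oo --> +oo ->
  vanishing_tails (fun n => kratio a n - 1) ->
  (fun n : nat => a n.+1 / a n) @ \oo --> (1 : R).
Proof.
move=> a0 ainfty carl hk.
have a_gt0 (n : nat) : 0 < a n by apply: a0.
pose u (n : nat) := ln (a n.+1 / a n).
have du n : u n.+1 - u n = - (2 * ln (kratio a n.+1)).
  have -> : 2 * ln (kratio a n.+1) = ln (kratio a n.+1 ^+ 2).
    by rewrite lnXn ?mulr_natl // divr_gt0 ?a_gt0 // sqrtr_gt0 mulr_gt0 ?a_gt0 // a0.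
  rewrite /kratio expr_div_n sqr_sqrtr; last first.
    by rewrite mulr_ge0 // ltW ?a_gt0 // a0.
  have -> : n.+1%:Z - 1 = n by rewrite -addn1 PoszD addrK.
  rewrite /u !ln_div ?posrE ?mulr_gt0 ?exprn_gt0 //.
  by rewrite lnM ?posrE // lnXn // mulr2n; ring.
have tail : vanishing_tails (fun n => u n.+1 - u n).
  have [N hN] := vanishing_tails_le1 (vanishing_tails_shift hk)
    (divr_gt0 ltr01 (ltr0Sn _ 1) : 0 < 1 / 2).
  apply: (vanishing_tails_le (N := N)
    (vanishing_tailsZ 4 (vanishing_tails_shift hk))) => n Nn.
  rewrite du normrN normrM [X in _ <= X]normrM !normr_nat.
  have := norm_ln_le (hN n Nn); lra.
have small e : 0 < e -> exists N, forall n, (N <= n)%N -> `|u n| <= e.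
  move=> e0; have e20 : 0 < e / 2 by rewrite divr_gt0.
  have [N hN] := vanishing_tails_cauchy tail e20.
  exists N => m Nm; rewrite leNgt; apply/negP; rewrite real_ltr_normr ?num_real //.
  case/orP => um.
    have growth n : (N <= n)%N -> (1 + e / 2) * a n <= a n.+1.
      move=> Nn; rewrite -ler_pdivlMr //; apply: le_trans (expR_ge1Dx _) _.
      rewrite -[leRHS]lnK ?posrE ?divr_gt0 // ler_expR -/(u n).
      by have := hN m n Nm Nn; rewrite ler_norml; lra.
    (* Under growth by the factor 1 + e/2 the reciprocals are dominated by telescoping differences,
       so their series stays bounded, against [carl]. *)
    have inv n : (N <= n)%N -> (a n.+1)^-1 <= (e / 2)^-1 * ((a n)^-1 - (a n.+1)^-1).
      move=> Nn; rewrite ler_pdivlMl // lerBrDr.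
      rewrite -[X in _ + X]mul1r -mulrDl ler_pdivrMr // ler_pdivlMl //.
      by rewrite mulrC addrC growth.
    have bnd n : (N <= n)%N ->
        \sum_(N.+1 <= j < n.+1) (a j)^-1 <= (e / 2)^-1 * ((a N)^-1 - (a n)^-1).
      elim: n => [|n ih] Nn.
        by move: Nn; rewrite leqn0 => /eqP->; rewrite big_geq // subrr mulr0.
      move: Nn; rewrite leq_eqVlt => /predU1P[<-|Nn].
        by rewrite big_geq // subrr mulr0.
      rewrite big_nat_recr //=; apply: le_trans (lerD (ih Nn) (inv n Nn)) _.
      by rewrite -mulrDr addrA subrK.
    move/cvgryPgt : carl => /(_ (\sum_(0 <= j < N.+1) (a j)^-1 + (e / 2)^-1 * (a N)^-1)).
    move=> [M _ hM]; have := hM (maxn M N).+1 (leqW (leq_maxl _ _)).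
    rewrite /series /= [X in _ < X](big_cat_nat (n := N.+1)) ?ltnS ?leq_maxr //=.
    rewrite ltrD2l ltNge; apply/negP; rewrite negbK.
    apply: le_trans (bnd _ (leq_maxr _ _)) _.
    by rewrite ler_pM2l ?invr_gt0 // gerBl invr_ge0 ltW.
  have decr n : (N <= n)%N -> a n.+1 <= a n.
    move=> Nn; rewrite -[leRHS]mul1r -ler_pdivrMr // -[leLHS]lnK ?posrE ?divr_gt0 //.
    rewrite -expR0 ler_expR -/(u n).
    by have := hN m n Nm Nn; rewrite ler_norml; lra.
  have bnd n : a (N + n)%N <= a N.
    by elim: n => [|n ih]; rewrite ?addn0 // addnS (le_trans (decr _ (leq_addr _ _))).
  move/cvgryPgt : ainfty => /(_ (a N))[M _ hM].
  by have := hM (N + M)%N (leq_addl _ _); rewrite /= ltNge bnd.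
have ucvg : u @ \oo --> (0 : R).
  apply/cvgrPdist_le => e e0; have [N hN] := small e e0.
  by exists N => // n Nn; rewrite sub0r normrN hN.
have -> : (fun n : nat => a n.+1 / a n) = expR \o u.
  by apply/funext => n /=; rewrite lnK // posrE divr_gt0.
by rewrite -expR0; apply: continuous_cvg => //; exact: continuous_expR.
Qed.

Lemma alpha_gt0 a n : (forall n : int, -1 <= n -> 0 < a n) -> 0 < alpha a n.
Proof.
move=> a0; rewrite invr_gt0 mulr_gt0 // sqrtr_gt0 mulr_gt0 ?a0 //.
by rewrite -subr_ge0 opprK subrK.
Qed.

Lemma alpha_cvg0 a : (forall n : int, -1 <= n -> 0 < a n) ->
  (fun n : nat => a n) @ \oo --> +oo -> alpha a @ \oo --> (0 : R).
Proof.
move=> a0 ainfty; have a_gt0 (n : nat) : 0 < a n by apply: a0.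
apply/cvgrPdist_le => e e0.
move/cvgryPge : ainfty => /(_ (e^-1))[N _ hN].
exists N.+1 => // -[//|n] /= Nn; rewrite sub0r normrN gtr0_norm ?alpha_gt0 //.
rewrite /alpha; have -> : n.+1%:Z - 1 = n by rewrite -addn1 PoszD addrK.
rewrite invf_ple ?posrE // ?mulr_gt0 ?sqrtr_gt0 ?mulr_gt0 //.
have ie0 : 0 < e^-1 by rewrite invr_gt0.
have : e^-1 <= Num.sqrt (a n * a n.+1).
  rewrite -(gtr0_norm ie0) -sqrtr_sqr ler_sqrt; last by rewrite mulr_ge0 // ltW.
  rewrite expr2; apply: ler_pM; [exact: ltW|exact: ltW| |].
    exact: (hN n Nn).
  exact: (hN n.+1 (leqW Nn)).
by lra.
Qed.

(** Once a_n <= 2 a_(n+1), alpha_(n+1) >= 1/(4 a_(n+1)), so Carleman's condition passes to the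
    alpha_n. The starting index [m] is free because the damping is used only from an index where the
    error terms are already small. *)
Lemma alpha_dvg a : (forall n : int, -1 <= n -> 0 < a n) ->
  series (fun n : nat => (a n)^-1) @ \oo --> +oo ->
  (fun n : nat => a n.+1 / a n) @ \oo --> (1 : R) ->
  forall A m, exists N, forall n, (N <= n)%N ->
    A <= \sum_(m <= j < n) alpha a j.+1.
Proof.
move=> a0 carl rat A m; have a_gt0 (n : nat) : 0 < a n by apply: a0.
have /cvgrPdist_le/(_ (1 / 2))[|N1 _ hN1] := rat; first by rewrite divr_gt0.
have lb n : (N1 <= n)%N -> (a n.+1)^-1 / 4 <= alpha a n.+1.
  move=> Nn; have := hN1 n Nn; rewrite ler_norml => /andP[_].
  rewrite lerBlDr -lerBlDl ler_pdivlMr // => h.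
  rewrite /alpha -invfM lef_pV2 ?posrE ?mulr_gt0 ?sqrtr_gt0 ?mulr_gt0 ?a0 //.
  have -> : n.+1%:Z - 1 = n by rewrite -addn1 PoszD addrK.
  have : Num.sqrt (a n * a n.+1) <= 2 * a n.+1.
    have a20 : 0 < 2 * a n.+1 by rewrite mulr_gt0.
    rewrite -(gtr0_norm a20) -sqrtr_sqr ler_sqrt ?sqr_ge0 //.
    by have := a_gt0 n; have := a_gt0 n.+1; nra.
  by lra.
pose p := maxn m N1.
move/cvgryPge : carl => /(_ (4 * A + \sum_(0 <= j < p.+1) (a j)^-1))[M _ hM].
exists (maxn M p) => n; rewrite geq_max => /andP[Mn pn].
have := hM n.+1 (leqW Mn).
rewrite /series /= [X in _ <= X](big_cat_nat (n := p.+1)) ?ltnS //=.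
rewrite [X in _ <= X]addrC lerD2r big_add1 /= => hs.
rewrite [X in _ <= X](big_cat_nat (n := p)) ?leq_maxl //=.
have h1 : 0 <= \sum_(m <= j < p) alpha a j.+1.
  by apply: sumr_ge0 => j _; rewrite ltW // alpha_gt0.
have h2 : \sum_(p <= j < n) (a j.+1)^-1 <= 4 * \sum_(p <= j < n) alpha a j.+1.
  rewrite mulr_sumr; apply: ler_sum_nat => j /andP[pj _].
  have := lb j (leq_trans (leq_maxr _ _) pj); lra.
by lra.
Qed.

End Coefficients.

(** * The branch of the square root *)

Section ComplexModulus.
Context {R : realType}.
Local Notation C := R[i].
Implicit Types (x y z w : C).

Lemma normcE x : `|x| = (normc x)%:C.
Proof. by case: x. Qed.

Lemma normc_ge0 x : 0 <= normc x.
Proof. by rewrite -ler0c -normcE. Qed.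

Lemma sqr_normcE x : normc x ^+ 2 = complex.Re x ^+ 2 + complex.Im x ^+ 2.
Proof. by case: x => a b /=; rewrite sqr_sqrtr // addr_ge0 ?sqr_ge0. Qed.

Lemma normcR (r : R) : normc r%:C = `|r|.
Proof. by rewrite /= expr0n /= addr0 sqrtr_sqr. Qed.

Lemma normcX x n : normc (x ^+ n) = normc x ^+ n.
Proof.
by elim: n => [|n ih]; rewrite ?expr0 ?normc1 // !exprS normcM ih.
Qed.

Lemma normc_distrC x y : normc (x - y) = normc (y - x).
Proof. by rewrite -normcN opprB. Qed.

Lemma ler_normcB x y : normc (x - y) <= normc x + normc y.
Proof. by apply: le_trans (le_normcD _ _) _; rewrite normcN. Qed.

Lemma ler_normc_dist x y : `|normc x - normc y| <= normc (x - y).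
Proof. exact: (@ler_dist_dist R (Rcomplex R)). Qed.

Lemma normc_ge_Im x : `|complex.Im x| <= normc x.
Proof.
rewrite -(ler_pXn2r (n := 2)) ?nnegrE ?normc_ge0 //.
by rewrite sqr_normcE real_normK ?num_real // lerDr sqr_ge0.
Qed.

(** Filter statements in the complex numbers quantify over complex radii, whose positivity forces a
    zero imaginary part; this reduces them to real estimates. *)
Lemma cvg_normcP (T : Type) (F : set_system T) (FF : Filter F) (f : T -> C) (l : C) :
  (f x : C^o) @[x --> F] --> (l : C^o) <->
  (normc (l - f x)) @[x --> F] --> (0 : R).
Proof.
split=> [/cvgrPdist_le h|/cvgrPdist_le h]; apply/cvgrPdist_le.
  move=> e e0; have : 0 < e%:C by rewrite ltcR.
  move=> /h; apply: filterS => t; rewrite normcE lecR => le.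
  by rewrite sub0r normrN ger0_norm // normc_ge0.
move=> [e1 e2] e0; have [e20 e10] : e2 = 0 /\ 0 < e1.
  by move: e0; rewrite ltcE /= => /andP[/eqP].
have := h e1 e10; apply: filterS => t.
by rewrite sub0r normrN ger0_norm ?normc_ge0 // normcE e20 lecR.
Qed.

Lemma cvg_normc (T : Type) (F : set_system T) (FF : Filter F) (f : T -> C) (l : C) :
  (f x : C^o) @[x --> F] --> (l : C^o) -> normc (f x) @[x --> F] --> normc l.
Proof.
move=> /cvg_normcP/cvgrPdist_le h; apply/cvgrPdist_le => e e0.
have := h e e0; apply: filterS => t; rewrite sub0r normrN.
rewrite ger0_norm ?normc_ge0 // => /(le_trans _); apply.
exact: ler_normc_dist.
Qed.

Lemma cvg_real_complex (T : Type) (F : set_system T) (FF : Filter F)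
    (f : T -> R) (l : R) :
  f x @[x --> F] --> l -> ((f x)%:C : C^o) @[x --> F] --> (l%:C : C^o).
Proof.
move=> /cvgrPdist_le h; apply/cvg_normcP/cvgrPdist_le => e e0.
have := h e e0; apply: filterS => t.
by rewrite sub0r normrN -rmorphB normcR normr_id.
Qed.

End ComplexModulus.

(** * Estimates for zeta and the square root off the cut *)

Section Branch.
Context {R : realType}.
Local Notation C := R[i].
Variables (s : C -> C) (hs : is_sqrt_branch s).
Implicit Types (z w : C).

Lemma Im_neq0_ncut z : complex.Im z != 0 -> ~ Defs.cut z.
Proof. by move=> iz [x _ xz]; move: iz; rewrite -xz /= eqxx. Qed.

Lemma sqrt_branchK z : ~ Defs.cut z -> zeta s z * (z + s z) = 1.
Proof.
by case: hs => _ s2 _ ncut; rewrite /zeta -subr_sqr s2 // subKr.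
Qed.

(** If |zeta| = 1, its inverse z + s z is its conjugate, so z is the real part of zeta and lies on
    the cut. *)
Lemma normc_zeta_neq1 z : ~ Defs.cut z -> normc (zeta s z) != 1.
Proof.
move=> ncut; apply/eqP => e1; apply: (ncut).
have := sqrt_branchK ncut.
have : z + z = zeta s z + (z + s z) by rewrite /zeta; ring.
have : complex.Re (zeta s z) ^+ 2 + complex.Im (zeta s z) ^+ 2 = 1.
  by rewrite -sqr_normcE e1 expr1n.
case: (zeta s z) => u v; case: (z + s z) => p q; case: z {ncut e1} => x y /=.
move=> uv [xE yE] [h1 h2].
have pu : p = u.
  transitivity (u * (u * p - v * q) + v * (u * q + v * p)).
    by rewrite -[LHS]mul1r -uv; ring.
  by rewrite h1 h2; ring.
have qv : q = - v.
  transitivity (- v * (u * p - v * q) + u * (u * q + v * p)).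
    by rewrite -[LHS]mul1r -uv; ring.
  by rewrite h1 h2; ring.
have xu : x = u by lra.
have y0 : y = 0 by lra.
exists x; last by rewrite y0.
by rewrite /= in_itv /= xu; nra.
Qed.

(** The segment from z to 2 avoids the cut; along it |zeta| is continuous and never 1, and at 2 it
    is below 1 by positivity of the branch. The intermediate value theorem concludes. *)
Lemma normc_zeta_lt1 z : complex.Im z != 0 -> normc (zeta s z) < 1.
Proof.
move=> iz; pose g (t : R) : C := z + t%:C * (2 - z).
have ncut t : ~ Defs.cut (g t).
  have [->|t1] := eqVneq t 1.
    rewrite /g mul1r addrC subrK => -[x]; rewrite /= in_itv /= => /andP[_ x1].
    by move/(congr1 (@complex.Re R)) => /= xE; move: x1; rewrite xE; lra.
  apply: Im_neq0_ncut; rewrite /g; case: z iz {g} => x y /= y0.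
  have -> : y + (t * (0 + 0 - y) + 0 * (1 + 1 - x)) = (1 - t) * y by ring.
  by rewrite mulf_neq0 // subr_eq0 eq_sym.
have cg t0 : (g t : C^o) @[t --> t0] --> (g t0 : C^o).
  apply: cvgD; first exact: cvg_cst.
  apply: cvgM; last exact: cvg_cst.
  by apply: cvg_real_complex; exact: cvg_id.
have cs t0 : (s (g t) : C^o) @[t --> t0] --> (s (g t0) : C^o).
  apply: (cvg_comp (g : R -> C^o) (s : C^o -> C^o)); first exact: cg.
  case: hs => ds _ _.
  have /derivable1_diffP := ds _ (ncut t0).
  exact: differentiable_continuous.
have cz : {within `[0, 1], continuous (fun t : R => normc (zeta s (g t)))}.
  apply: continuous_in_subspaceT => t0 _; apply: cvg_normc.
  by apply: cvgB; [exact: cg|exact: cs].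
have end1 : normc (zeta s (g 1)) < 1.
  case: hs => _ s2 s0.
  have g1 : g 1 = 2%:C by rewrite /g mul1r addrC subrK rmorph_nat.
  have := s0 2 _; rewrite ltr1n => /(_ isT).
  have := sqrt_branchK (ncut 1); rewrite g1 /zeta.
  case: (s 2%:C) => p q h; rewrite ltcE /= => /andP[/eqP q0 p0].
  move: h; rewrite q0 => -[h _]; rewrite subr0 expr0n addr0 sqrtr_sqr.
  rewrite ltr_norml; nra.
rewrite ltNge; apply/negP => ge1.
have [|c _ gc] := IVT ler01 cz (v := 1); last first.
  by have := normc_zeta_neq1 (ncut c); rewrite gc eqxx.
have -> : g 0 = z by rewrite /g mul0r addr0.
by rewrite ge_min le_max ge1 (ltW end1) orbT.
Qed.

(** Write z = x + i y and s z = p + i q. From |z - s z| < 1 < |z + s z| follows x p + y q > 0, and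
    the imaginary part of (s z)^2 = z^2 - 1 gives p q = x y; hence q y (p^2 + y^2) = y^2 (x p + y q)
    > 0. *)
Lemma Im_sqrt_branch z : complex.Im z != 0 -> 0 < complex.Im (s z) * complex.Im z.
Proof.
move=> iz; have ncut := Im_neq0_ncut iz.
have zlt := normc_zeta_lt1 iz.
have := sqrt_branchK ncut.
case: hs => _ /(_ z ncut) + _; rewrite !expr2.
move: zlt iz {ncut}; rewrite -(ltr_pXn2r (n := 2)) ?nnegrE ?normc_ge0 // sqr_normcE.
rewrite /zeta; case: z => x y; case: (s _) => p q /= lt1 y0 [e1 e2] [e3 e4].
rewrite expr1n in lt1.
have e : ((x - p) ^+ 2 + (y - q) ^+ 2) * ((x + p) ^+ 2 + (y + q) ^+ 2) = 1.
  transitivity (((x - p) * (x + p) - (y - q) * (y + q)) ^+ 2 +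
    ((x - p) * (y + q) + (y - q) * (x + p)) ^+ 2); first by ring.
  by rewrite e3 e4 expr0n addr0 expr1n.
have D0 : 0 < x * p + y * q.
  have : 1 < (x + p) ^+ 2 + (y + q) ^+ 2.
    rewrite ltNge; apply/negP => le1; move: e; apply/eqP; rewrite lt_eqF //.
    apply: le_lt_trans lt1; rewrite ler_piMr // addr_ge0 ?sqr_ge0 //.
  by move: lt1; lra.
have y2 : 0 < y ^+ 2 by rewrite exprn_even_gt0.
have p2 : 0 < p ^+ 2 + y ^+ 2 by rewrite ltr_wpDl ?sqr_ge0.
rewrite -(pmulr_lgt0 _ p2).
have -> : (q * y) * (p ^+ 2 + y ^+ 2) = y ^+ 2 * (x * p + y * q).
  transitivity (p * y * ((p * q + q * p) / 2) + y ^+ 2 * (y * q)); first by field.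
  by rewrite e2; field.
exact: mulr_gt0.
Qed.

(* [z + s z] is the inverse of [zeta s z], and the imaginary part of
   [2 z = zeta s z + (zeta s z)^-1] bounds [|zeta s z|^-1 - |zeta s z|]. *)
Lemma normc_zeta_decay z : complex.Im z != 0 ->
  normc (zeta s z) * (1 + `|complex.Im z|) <= 1.
Proof.
move=> iz; have := sqrt_branchK (Im_neq0_ncut iz).
have := normc_ge_Im (zeta s z).
have := sqr_normcE (zeta s z); have := normc_zeta_lt1 iz.
have : z + z = zeta s z + (z + s z) by rewrite /zeta; ring.
have := normc_ge0 (zeta s z); move: (normc _) => n n0.
case: (zeta s z) => u v; case: (z + s z) => p q; case: z {iz} => x y /=.
move=> [_ yE] n1 nE vn [h1 h2].
have qv : q * n ^+ 2 = - v.
  transitivity (- v * (u * p - v * q) + u * (u * q + v * p)).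
    by rewrite nE; ring.
  by rewrite h1 h2; ring.
have [n00|n_neq0] := eqVneq n 0; first by rewrite n00 mul0r.
have n_gt0 : 0 < n by rewrite lt_def n_neq0.
have key : 2 * `|y| * n <= 1 - n ^+ 2.
  rewrite -(ler_pM2r n_gt0).
  have -> : 2 * `|y| * n * n = `|v * (1 - n ^+ 2)|.
    have -> : v * (1 - n ^+ 2) = - (2 * y * n ^+ 2).
      have -> : 2 * y = v + q by lra.
      by rewrite mulrDl qv; ring.
    by rewrite normrN normrM (ger0_norm (sqr_ge0 n)) normrM normr_nat; ring.
  rewrite normrM mulrC [`|1 - _|]ger0_norm; last by nra.
  by rewrite ler_wpM2l //; nra.
by nra.
Qed.

(* On the disc [normc z <= r < 1] the real part of [s z ^+ 2 = z ^+ 2 - 1] is at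
   most [r ^+ 2 - 1], which keeps [Im (s z)] away from 0. *)
Lemma Im_sqrt_branch_ge (r : R) z : complex.Im z != 0 -> normc z <= r -> 0 <= r ->
  1 - r ^+ 2 <= complex.Im (s z) ^+ 2.
Proof.
move=> iz zr r0; case: hs => _ /(_ z (Im_neq0_ncut iz)) + _; rewrite !expr2.
have := sqr_normcE z; have := normc_ge0 z; move: zr; move: (normc z) => n.
case: z iz => x y /= _ nr n0 nE; case: (s _) => p q /= [e1 _].
by nra.
Qed.

(** Factor the difference of squares: imaginary parts of equal sign give |s z + t| >= 2 k, while |z
    + w| <= 2. The root [t] is arbitrary, so that [w] may also be the limit point on the cut with a
    boundary value of the branch. *)
Lemma normc_sqrt_branchB (k : R) z w t : 0 < k ->
  complex.Im z != 0 -> k <= `|complex.Im (s z)| ->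
  k <= `|complex.Im t| -> 0 < complex.Im (s z) * complex.Im t -> t ^+ 2 = w ^+ 2 - 1 ->
  normc z <= 1 -> normc w <= 1 -> normc (s z - t) * k <= normc (z - w).
Proof.
move=> k0 iz sk tk st t2 z1 w1.
have e : (s z - t) * (s z + t) = (z - w) * (z + w).
  case: hs => _ /(_ z (Im_neq0_ncut iz)) s2 _.
  by rewrite -!subr_sqr s2 t2; ring.
have low : 2 * k <= normc (s z + t).
  apply: le_trans (normc_ge_Im _).
  have -> : complex.Im (s z + t) = complex.Im (s z) + complex.Im t.
    by case: (s z); case: (t).
  move: sk tk.
  have [h1|h1] := ltP 0 (complex.Im t).
    have h2 : 0 < complex.Im (s z) by rewrite pmulr_lgt0 in st.
    by rewrite !gtr0_norm ?addr_gt0 //; lra.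
  have h3 : complex.Im t < 0.
    by rewrite lt_neqAle h1 andbT; apply/eqP => t0; move: st; rewrite t0 mulr0 ltxx.
  have h2 : complex.Im (s z) < 0 by rewrite nmulr_lgt0 in st.
  by rewrite !ltr0_norm; lra.
have up : normc (z + w) <= 2 by apply: le_trans (le_normcD _ _) _; lra.
move/(congr1 (@normc R)) : e; rewrite !normcM => e.
have := normc_ge0 (s z - t); have := normc_ge0 (z - w).
by nra.
Qed.

Lemma normc_zeta_ge z : complex.Im z != 0 -> normc z <= 1 -> 1 / 3 <= normc (zeta s z).
Proof.
move=> iz z1; have := sqrt_branchK (Im_neq0_ncut iz).
move=> /(congr1 (@normc R)); rewrite normcM normc1.
have -> : z + s z = z + z - zeta s z by rewrite /zeta; ring.
have := ler_normcB (z + z) (zeta s z); have := le_normcD z z.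
have := normc_zeta_lt1 iz; have := normc_ge0 (zeta s z).
have := normc_ge0 (z + z - zeta s z).
by nra.
Qed.

(** This separates the roots 1 and zeta^2: 1 - zeta^2 = 2 zeta s(z), with |zeta| >= 1/3 and |s(z)|
    >= k. *)
Lemma normc_sub_sqr_zeta (k : R) z : complex.Im z != 0 -> normc z <= 1 ->
  k <= `|complex.Im (s z)| -> 2 / 3 * k <= normc (1 - zeta s z ^+ 2).
Proof.
move=> iz z1 sk.
have -> : 1 - zeta s z ^+ 2 = zeta s z * (2 * s z).
  transitivity (zeta s z * (z + s z) - zeta s z ^+ 2).
    by rewrite sqrt_branchK //; exact: Im_neq0_ncut.
  by rewrite /zeta; ring.
have := normc_ge_Im (s z); have := normc_zeta_ge iz z1.
have -> : 2 * s z = s z + s z by ring.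
have := le_trans sk (normc_ge_Im (s z)).
have -> : s z + s z = 2%:R%:C * s z by rewrite rmorph_nat; ring.
by rewrite !normcM normcR normr_nat; have := normc_ge0 (s z); nra.
Qed.

End Branch.

(** * A perturbed three-term recurrence *)

Section Recurrence.
Context {R : realType}.
Local Notation C := R[i].

(** The inductive bound is linear in the partial sum S of g; it propagates because (1 + 2 S) (1 + g)
    <= 1 + 2 (S + g) when 2 S <= 1. *)
Lemma discrete_gronwall (W g : nat -> R) m :
  (forall n, 0 <= g n) -> 0 <= W m ->
  (forall n, (m <= n)%N -> W n.+1 <= W n * (1 + g n)) ->
  (forall n, \sum_(m <= j < n) g j <= 1 / 2) ->
  forall n, (m <= n)%N -> W n <= 2 * W m.
Proof.
move=> g0 W0 step small.
have bnd n : (m <= n)%N -> W n <= W m * (1 + 2 * \sum_(m <= j < n) g j).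
  elim: n => [|n ih].
    by rewrite leqn0 => /eqP->; rewrite big_geq // mulr0 addr0 mulr1.
  rewrite leq_eqVlt => /predU1P[<-|mn].
    by rewrite big_geq // mulr0 addr0 mulr1.
  rewrite big_nat_recr //=; apply: le_trans (step _ mn) _.
  have gn : 0 <= 1 + g n by rewrite addr_ge0.
  apply: le_trans (ler_wpM2r gn (ih mn)) _; rewrite -mulrA ler_wpM2l //.
  have := small n; have := g0 n; nra.
move=> n mn; apply: le_trans (bnd n mn) _; rewrite mulrC ler_wpM2r //.
by have := small n; lra.
Qed.

Lemma normc_telescope (x : nat -> C) (g : nat -> R) m :
  (forall n, (m <= n)%N -> normc (x n.+1 - x n) <= g n) ->
  forall n p, (m <= p)%N -> (p <= n)%N -> normc (x n - x p) <= \sum_(p <= j < n) g j.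
Proof.
move=> hx n p mp; elim: n => [|n ih].
  by rewrite leqn0 => /eqP->; rewrite subrr normc0 big_geq.
rewrite leq_eqVlt => /predU1P[->|pn]; first by rewrite subrr normc0 big_geq.
rewrite big_nat_recr //= addrC.
have -> : x n.+1 - x p = (x n.+1 - x n) + (x n - x p) by ring.
by apply: le_trans (le_normcD _ _) (lerD (hx _ (leq_trans mp pn)) (ih pn)).
Qed.

(** Both errors have the form u (z1 - z0) f0 + (1 - k) f2 with |u| <= 1. As k >= 1/2, the recurrence
    gives |f2| <= 4 |f1| + 2 |f0|; with |f1| <= |f1 - f0| + |f0| this makes |f0| + |f2| <= 4 W + 7 W
    / c. *)
Lemma recurrence_step (z0 z1 f0 f1 f2 : C) (k e c : R) :
  0 < c -> normc z0 <= 1 -> normc z1 <= 1 -> c <= normc (1 - z0 ^+ 2) ->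
  normc (z1 - z0) <= e -> `|k - 1| <= e -> e <= 1 / 2 ->
  k%:C * f2 = (1 + z1 ^+ 2) * f1 - z1 * z0 * f0 ->
  let W := normc (f1 - z0 ^+ 2 * f0) + normc (f1 - f0) in
  [/\ normc f0 <= W / c,
   normc ((f2 - z1 ^+ 2 * f1) - (f1 - z0 ^+ 2 * f0)) <= (4 + 7 / c) * e * W &
   normc ((f2 - f1) - z1 ^+ 2 * (f1 - f0)) <= (4 + 7 / c) * e * W].
Proof.
move=> c0 z01 z11 cz ze ke e2 rec W.
have n0 := @normc_ge0 R; have e0 : 0 <= e := le_trans (n0 _) ze.
have hf0 : normc f0 <= W / c.
  rewrite ler_pdivlMr // mulrC; apply: le_trans (ler_wpM2r (n0 f0) cz) _.
  rewrite -normcM.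
  have -> : (1 - z0 ^+ 2) * f0 = (f1 - z0 ^+ 2 * f0) - (f1 - f0) by ring.
  exact: ler_normcB.
have hf1 : normc f1 <= normc (f1 - f0) + normc f0.
  by apply: le_trans (le_normcD _ _); rewrite subrK.
have hf2 : normc f2 <= 4 * normc f1 + 2 * normc f0.
  have : k * normc f2 <= 2 * normc f1 + normc f0.
    apply: (@le_trans _ _ (normc (k%:C * f2))).
      by rewrite normcM normcR ler_wpM2r // ler_norm.
    rewrite rec; apply: le_trans (ler_normcB _ _) _; rewrite !normcM.
    have a1 : normc (1 + z1 ^+ 2) <= 2.
      apply: le_trans (le_normcD _ _) _; rewrite normc1 normcX.
      by have := n0 z1; nra.
    have a2 : normc z1 * normc z0 <= 1 by rewrite mulr_ile1.
    by have := n0 f1; have := n0 f0; nra.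
  by move: ke; rewrite ler_norml => /andP[ke _]; have := n0 f2; nra.
have YW : normc (f1 - f0) <= W by rewrite lerDr.
have W0 : 0 <= W by rewrite addr_ge0.
have bnd : normc f0 + normc f2 <= (4 + 7 / c) * W.
  have -> : (4 + 7 / c) * W = 4 * W + 7 * (W / c) by ring.
  lra.
have fin (u : C) : normc u <= 1 ->
    normc (u * (z1 - z0) * f0 + (1 - k)%:C * f2) <= (4 + 7 / c) * e * W.
  move=> u1; apply: le_trans (le_normcD _ _) _; rewrite !normcM normcR distrC.
  apply: (@le_trans _ _ (e * (normc f0 + normc f2))); last by nra.
  rewrite mulrDr lerD ?ler_wpM2r //.
  by apply: le_trans ze; rewrite ler_piMl.
split => //.
  have -> : (f2 - z1 ^+ 2 * f1) - (f1 - z0 ^+ 2 * f0)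
    = (- z0) * (z1 - z0) * f0 + (1 - k)%:C * f2.
    by rewrite rmorphB rmorph1 mulrBl rec; ring.
  by apply: fin; rewrite normcN.
have -> : (f2 - f1) - z1 ^+ 2 * (f1 - f0)
    = z1 * (z1 - z0) * f0 + (1 - k)%:C * f2.
  by rewrite rmorphB rmorph1 mulrBl rec; ring.
exact: fin.
Qed.

(** The parameter t runs through the set on which uniformity is wanted: every constant chosen in the
    proof depends on [h], [d], [c] and on bounds for two consecutive values of F, never on t. *)
Lemma recurrence_uniform_cauchy (T : Type) (D : set T) (zt F : T -> nat -> C)
    (k h d : nat -> R) (c : R) (N0 : nat) :
  0 < c -> vanishing_tails h -> (forall n, 0 <= d n) ->
  (forall A m, exists N, forall n, (N <= n)%N -> A <= \sum_(m <= j < n) d j) ->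
  (forall n, `|k n.+1 - 1| <= `|h n|) ->
  (forall n, exists M, forall t, D t -> normc (F t n) <= M) ->
  (forall t n, D t -> (N0 <= n)%N ->
    [/\ normc (zt t n) <= 1, normc (zt t n.+1) * (1 + d n) <= 1,
     c <= normc (1 - zt t n ^+ 2), normc (zt t n.+1 - zt t n) <= `|h n| &
     (k n.+1)%:C * F t n.+2 =
       (1 + zt t n.+1 ^+ 2) * F t n.+1 - zt t n.+1 * zt t n * F t n]) ->
  forall e, 0 < e -> exists N, forall t n p, D t -> (N <= n)%N -> (N <= p)%N ->
    normc (F t n - F t p) <= e /\ normc (F t n.+1 - F t n) <= e.
Proof.
move=> c0 ht d0 ddvg kh Fbnd rec e e0.
pose C1 : R := 4 + 7 / c.
have C10 : 0 < C1 by rewrite addr_gt0 // divr_gt0.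
pose g n : R := C1 * `|h n|.
have g0 n : 0 <= g n by rewrite mulr_ge0 // ltW.
(* In the Gronwall sums g is doubled because X and Y each contribute an error g W. *)
have [m [N0m hm hg]] : exists m, [/\ (N0 <= m)%N,
    forall n, (m <= n)%N -> `|h n| <= 1 / 2 & forall n, \sum_(m <= j < n) (2 * g j) <= 1 / 2].
  have half : 0 < 1 / 2 :> R by rewrite divr_gt0.
  have [N1 hN1] := vanishing_tails_le1 ht half.
  have [N2 hN2] := vanishing_tailsZ (2 * C1) ht half.
  exists (maxn N0 (maxn N1 N2)); split; first exact: leq_maxl.
    by move=> n; rewrite !geq_max => /and3P[_ n1 _]; exact: hN1.
  move=> n; have := hN2 (maxn N0 (maxn N1 N2)) n.
  rewrite !leq_max leqnn !orbT => /(_ isT); apply: le_trans.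
  have C20 : 0 <= 2 * C1 by rewrite mulr_ge0 // ltW.
  by apply: ler_sum => j _; rewrite normrM (ger0_norm C20) /g mulrA.
pose X t n := F t n.+1 - zt t n ^+ 2 * F t n.
pose Y t n := F t n.+1 - F t n.
pose W t n := normc (X t n) + normc (Y t n).
have W0 t n : 0 <= W t n by rewrite addr_ge0 ?normc_ge0.
have step t n : D t -> (m <= n)%N ->
  [/\ normc (F t n) <= W t n / c,
   normc (X t n.+1 - X t n) <= g n * W t n &
   normc (Y t n.+1 - zt t n.+1 ^+ 2 * Y t n) <= g n * W t n].
  move=> Dt mn; have Nn := leq_trans N0m mn.
  have [z1 _ cz zh fr] := rec t n Dt Nn.
  have [z1' _ _ _ _] := rec t n.+1 Dt (leqW Nn).
  exact: (recurrence_step c0 z1 z1' cz zh (kh n) (hm n mn) fr).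
have YW t n : D t -> (m <= n)%N ->
    normc (Y t n.+1) <= normc (zt t n.+1) * normc (Y t n) + g n * W t n.
  move=> Dt mn; have [_ _ h3] := step t n Dt mn.
  have [z1 _ _ _ _] := rec t n.+1 Dt (leqW (leq_trans N0m mn)).
  rewrite -[Y t n.+1](subrK (zt t n.+1 ^+ 2 * Y t n)).
  apply: le_trans (le_normcD _ _) _; rewrite addrC lerD // normcM normcX.
  by rewrite ler_wpM2r ?normc_ge0 // expr2 ler_piMl ?normc_ge0.
have [M0 hM0] := Fbnd m; have [M1 hM1] := Fbnd m.+1.
(* Gronwall's factor 2 times |X| + |Y| <= 2 |F m.+1| + 2 |F m|; absolute values, since M0 and M1 may
   be negative when D is empty. *)
pose M := 2 * (2 * `|M1| + 2 * `|M0|).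
have M_ge0 : 0 <= M by rewrite mulr_ge0 // addr_ge0 // mulr_ge0.
have WM t n : D t -> (m <= n)%N -> W t n <= M.
  move=> Dt mn.
  have h1 : W t n <= 2 * W t m.
    apply: (discrete_gronwall (g := fun j => 2 * g j)) => //.
      by move=> j; rewrite mulr_ge0.
    move=> j mj; have [_ h2 h3] := step t j Dt mj.
    have h4 := YW t j Dt mj.
    have [z1 _ _ _ _] := rec t j.+1 Dt (leqW (leq_trans N0m mj)).
    have h5 : normc (X t j.+1) <= normc (X t j) + g j * W t j.
      rewrite -[X t j.+1](subrK (X t j)); apply: le_trans (le_normcD _ _) _.
      by rewrite addrC lerD2l.
    have h6 : normc (zt t j.+1) * normc (Y t j) <= normc (Y t j).
      by rewrite ler_piMl ?normc_ge0.
    by rewrite /W mulrDr mulr1 -/(W t j); rewrite {1}/W; lra.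
  apply: le_trans h1 _; rewrite ler_pM2l //.
  have a0 := le_trans (hM0 t Dt) (ler_norm M0).
  have a1 := le_trans (hM1 t Dt) (ler_norm M1).
  have [z1 _ _ _ _] := rec t m Dt N0m.
  have h1' := ler_normcB (F t m.+1) (zt t m ^+ 2 * F t m).
  have h2' := ler_normcB (F t m.+1) (F t m).
  have h3' : normc (zt t m ^+ 2 * F t m) <= normc (F t m).
    by rewrite normcM normcX ler_piMl ?normc_ge0 // exprn_ile1 ?normc_ge0.
  by rewrite /W /X /Y; lra.
have Xtail t n p : D t -> (m <= p)%N -> (p <= n)%N ->
    normc (X t n - X t p) <= M * C1 * \sum_(p <= j < n) `|h j|.
  move=> Dt mp pn; rewrite mulr_sumr.
  apply: (normc_telescope (m := m)) => // j mj; have [_ h2 _] := step t j Dt mj.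
  apply: le_trans h2 _.
  have -> : M * C1 * `|h j| = g j * M by rewrite /g; ring.
  by rewrite ler_wpM2l // WM.
have ztail t n p : D t -> (m <= p)%N -> (p <= n)%N ->
    normc (zt t n - zt t p) <= \sum_(p <= j < n) `|h j|.
  move=> Dt mp pn; apply: (normc_telescope (m := m)) => // j mj.
  by have [_ _ _ + _] := rec t j Dt (leq_trans N0m mj).
(* One factor |zeta_(j+1)| <= 1/(1 + d_j) per step suffices, since the product of the 1 + d_j is at
   least 1 plus their sum; the errors simply add up. *)
have Ytail t n p : D t -> (m <= p)%N -> (p <= n)%N ->
    normc (Y t n) <=
      M / (1 + \sum_(p <= j < n) d j) + M * C1 * \sum_(p <= j < n) `|h j|.
  move=> Dt mp; elim: n => [|n ih].
    rewrite leqn0 => /eqP p0; rewrite !big_geq ?p0 // addr0 divr1 mulr0 addr0.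
    by apply: le_trans (WM t 0%N Dt _); rewrite ?lerDr ?normc_ge0 // -p0.
  rewrite leq_eqVlt => /predU1P[<-|pn].
    rewrite !big_geq // addr0 divr1 mulr0 addr0.
    by apply: le_trans (WM t p Dt mp); rewrite lerDr normc_ge0.
  have mn : (m <= n)%N := leq_trans mp pn.
  apply: le_trans (YW t n Dt mn) _; rewrite !big_nat_recr //=.
  have [_ zd _ _ _] := rec t n Dt (leq_trans N0m mn).
  have := ih pn; set S := \sum_(p <= j < n) d j; set H := \sum_(p <= j < n) _.
  have S0 : 0 <= S by apply: sumr_ge0.
  have H0 : 0 <= H by apply: sumr_ge0.
  have MC : 0 <= M * C1 by rewrite mulr_ge0 // ltW.
  move=> hY; rewrite [M * C1 * _]mulrDr [X in _ <= X]addrA; apply: lerD; last first.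
    have -> : M * C1 * `|h n| = g n * M by rewrite /g; ring.
    by rewrite ler_wpM2l // WM.
  have zn := normc_ge0 (zt t n.+1); have dn := d0 n.
  apply: le_trans (ler_wpM2l zn hY) _; rewrite mulrDr; apply: lerD; last first.
    have [z1 _ _ _ _] := rec t n.+1 Dt (leqW (leq_trans N0m mn)).
    by apply: ler_piMl z1; apply: mulr_ge0.
  rewrite ler_pdivlMr; last by lra.
  have -> : normc (zt t n.+1) * (M / (1 + S)) * (1 + (S + d n)) =
     M * (normc (zt t n.+1) * ((1 + (S + d n)) / (1 + S))) by ring.
  rewrite ler_piMr //; apply: le_trans zd; rewrite ler_wpM2l // ler_pdivrMr; last by lra.
  by nra.
(* The factor c/(1 + c) is below both c and 1. The final estimate spends e1 on the X and zeta terms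
   together and 2 e1 on each of the two Y terms. *)
pose e1 := c * e / (8 * (1 + c)).
have c1 : 0 < 8 * (1 + c) by rewrite mulr_gt0 // addr_gt0.
have e1_gt0 : 0 < e1 by rewrite divr_gt0 // mulr_gt0.
have e1c : 8 * e1 <= c * e.
  by rewrite /e1 mulrA ler_pdivrMr // ; have : 0 < c * e := mulr_gt0 c0 e0; nra.
have e1e : 8 * e1 <= e.
  by rewrite /e1 mulrA ler_pdivrMr // ; nra.
pose B := M * C1 + 2 * M / c + 1.
have MC0 : 0 <= M * C1 by rewrite mulr_ge0 // ltW.
have Mc0 : 0 <= 2 * M / c by rewrite !mulr_ge0 // invr_ge0 ltW.
have B0 : 0 < B by rewrite /B; lra.
have [p1 hp1] := ht _ (divr_gt0 e1_gt0 B0).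
pose p0 := maxn m p1.
have [N hN] := ddvg (M / e1) p0.
have mp0 : (m <= p0)%N by exact: leq_maxl.
have tail n p : (p0 <= p)%N -> \sum_(p <= j < n) `|h j| * B <= e1.
  by move=> pp; rewrite -mulr_suml -ler_pdivlMr //; apply/hp1/(leq_trans (leq_maxr _ _) pp).
have small t n : D t -> (maxn p0 N <= n)%N -> normc (Y t n) <= 2 * e1.
  rewrite geq_max => Dt /andP[pn Nn].
  apply: le_trans (Ytail t n p0 Dt mp0 pn) _.
  have := hN n Nn; have := tail n p0 (leqnn _); rewrite -mulr_suml.
  have : 0 <= \sum_(p0 <= j < n) `|h j| by apply: sumr_ge0.
  have : 0 <= \sum_(p0 <= j < n) d j by apply: sumr_ge0.
  set S := \sum_(_ <= j < _) d j; set H := \sum_(_ <= j < _) _ => S0 H0 hH hS.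
  have -> : 2 * e1 = e1 + e1 by ring.
  apply: lerD; last by move: hH; rewrite /B; nra.
  rewrite ler_pdivrMr; last by lra.
  by move: hS; rewrite ler_pdivrMr //; nra.
exists (maxn p0 N).
suff main t n p : D t -> (p <= n)%N -> (maxn p0 N <= p)%N ->
    normc (F t n - F t p) <= e.
  move=> t n p Dt Nn Np; split; last by apply: le_trans (small t n Dt Nn) _; lra.
  have [pn|/ltnW np] := leqP p n; first exact: main.
  by rewrite normc_distrC; exact: main.
move=> Dt pn Np; have Nn := leq_trans Np pn.
have pp : (p0 <= p)%N := leq_trans (leq_maxl _ _) Np.
have mp := leq_trans mp0 pp; have mn := leq_trans mp pn.
have [z1 _ cz _ _] := rec t n Dt (leq_trans N0m mn).
have [z1p _ _ _ _] := rec t p Dt (leq_trans N0m mp).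
have [Fp _ _] := step t p Dt mp.
have FM : normc (F t p) <= M / c.
  by apply: le_trans Fp _; rewrite ler_pM2r ?invr_gt0 // WM.
rewrite -(ler_pM2l c0); apply: le_trans (ler_wpM2r (normc_ge0 _) cz) _.
rewrite -normcM.
(* Subtract X - Y = (1 - zeta^2) F at p from the same identity at n; the middle term pays for
   replacing zeta_p by zeta_n. *)
have -> : (1 - zt t n ^+ 2) * (F t n - F t p) =
  (X t n - X t p) + (zt t n - zt t p) * (zt t n + zt t p) * F t p - (Y t n - Y t p).
  by rewrite /X /Y; ring.
apply: le_trans (ler_normcB _ _) _.
have h1 := le_normcD (X t n - X t p) ((zt t n - zt t p) * (zt t n + zt t p) * F t p).
have h2 := ler_normcB (Y t n) (Y t p).
have h3 := small t n Dt Nn; have h4 := small t p Dt Np.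
have h5 := Xtail t n p Dt mp pn.
have := tail n p pp; rewrite -mulr_suml.
have := ztail t n p Dt mp pn; move: h5.
have : 0 <= \sum_(p <= j < n) `|h j| by apply: sumr_ge0.
set H := \sum_(_ <= j < _) _ => H0 h5 h6 h7.
have h8 : normc ((zt t n - zt t p) * (zt t n + zt t p) * F t p) <= 2 * M / c * H.
  rewrite !normcM.
  have : normc (zt t n + zt t p) <= 2 by apply: le_trans (le_normcD _ _) _; lra.
  move=> h9.
  have -> : 2 * M / c * H = H * 2 * (M / c) by ring.
  by rewrite !ler_pM ?mulr_ge0 ?normc_ge0.
have h10 : M * C1 * H + 2 * M / c * H <= e1 by move: h7; rewrite /B; nra.
lra.
Qed.

End Recurrence.

(** * Weighted orthogonal polynomials *)

Section JacobiAsymptotics.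
Context {R : realType} (a : int -> R) (b : nat -> R).
Local Notation C := R[i].
Variables (sq : C -> C) (N0 : nat).
Hypothesis a_gt0 : forall n : int, -1 <= n -> 0 < a n.
Hypothesis sq_branch : is_sqrt_branch sq.

Let a_nat_gt0 (n : nat) : 0 < a n. Proof. exact: a_gt0. Qed.

Definition spectral_point (n : nat) (z : C) : C :=
  (alpha a n)%:C * z + (beta a b n)%:C.

Local Notation lam := spectral_point.
Local Notation zt n z := (zeta sq (lam n z)).
Local Notation q := (qprod sq a b N0).

Definition weighted_orthopoly (z : C) (n : nat) : C :=
  (Num.sqrt (a n))%:C * q z n * orthopoly a b z n.

Local Notation F := weighted_orthopoly.

Lemma Im_spectral_point n z : complex.Im (lam n z) = alpha a n * complex.Im z.
Proof. by case: z => x y; rewrite /lam /=; ring. Qed.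

Lemma Im_spectral_point_neq0 n z : complex.Im z != 0 -> complex.Im (lam n z) != 0.
Proof. by move=> iz; rewrite Im_spectral_point mulf_neq0 // gt_eqF // alpha_gt0. Qed.

Lemma qprodS n z : (N0 <= n)%N -> q z n.+1 = q z n * zt n z.
Proof. by move=> Nn; rewrite /qprod big_nat_recr. Qed.

Lemma normc_qprod_le1 n z : complex.Im z != 0 -> normc (q z n) <= 1.
Proof.
move=> iz; rewrite /qprod; apply: (big_ind (fun x : C => normc x <= 1)) => [|x y x1 y1|j _].
- by rewrite normc1.
- by rewrite normcM mulr_ile1 ?normc_ge0.
- exact/ltW/(normc_zeta_lt1 sq_branch)/Im_spectral_point_neq0.
Qed.

Lemma orthopoly_bounded (r : R) (n : nat) :
  exists M, forall z, normc z <= r -> normc (orthopoly a b z n) <= M.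
Proof.
suff : exists M, forall z, normc z <= r -> normc (orthopoly_pair a b z n).1 <= M /\
   normc (orthopoly_pair a b z n).2 <= M.
  by case=> M hM; exists M => z /hM[].
elim: n => [|n [M hM]].
  by exists 1 => z _; split; [rewrite [leLHS]normc0|rewrite [leLHS]normc1].
exists (`|M| + (((`|r| + `|b n|) * `|M| + `|a (n%:Z - 1)| * `|M|) * `|(a n)^-1|)) => z zr.
have := hM z zr; rewrite /=; case: (orthopoly_pair a b z n) => p0 p1 /= [h0 h1].
have M0 := ler_norm M; have h0' := le_trans h0 M0; have h1' := le_trans h1 M0.
have H : normc ((z - (b n)%:C) * p1 - (a (n%:Z - 1))%:C * p0) <=
  (`|r| + `|b n|) * `|M| + `|a (n%:Z - 1)| * `|M|.
  apply: le_trans (ler_normcB _ _) _; rewrite !normcM normcR; apply: lerD.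
    apply: ler_pM; rewrite ?normc_ge0 //.
    apply: le_trans (ler_normcB _ _) _; rewrite normcR lerD2r.
    exact: le_trans zr (ler_norm _).
  by rewrite ler_wpM2l.
split.
  by apply: le_trans h1' _; rewrite lerDl !(mulr_ge0, addr_ge0).
rewrite normcM normcV normcR -normfV; apply: ler_wpDl => //.
by rewrite ler_wpM2r.
Qed.

Lemma weighted_orthopoly_bounded (r : R) (n : nat) : exists M, forall z,
  normc z <= r -> complex.Im z != 0 -> normc (F z n) <= M.
Proof.
have [M hM] := orthopoly_bounded r n; exists (Num.sqrt (a n) * 1 * M) => z zr iz.
rewrite !normcM normcR ger0_norm ?sqrtr_ge0 //.
rewrite ler_pM ?mulr_ge0 ?sqrtr_ge0 ?normc_ge0 ?hM //.
by rewrite ler_wpM2l ?sqrtr_ge0 ?normc_qprod_le1.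
Qed.

(** The quadratic equation zeta^2 - 2 lambda zeta + 1 = 0 turns 1 + zeta^2 into 2 lambda zeta; the
    rest is the Jacobi equation at n+1, rescaled. From N0 on, q gains a factor zeta at each step. *)
Lemma weighted_orthopoly_rec n z : (N0 <= n)%N -> complex.Im z != 0 ->
  (kratio a n.+1)%:C * F z n.+2 =
  (1 + zt n.+1 z ^+ 2) * F z n.+1 - zt n.+1 z * zt n z * F z n.
Proof.
move=> Nn iz.
have jac := orthopoly_jacobi b z a_nat_gt0 n.+1.
have zE := sqrt_branchK sq_branch (Im_neq0_ncut (Im_spectral_point_neq0 n.+1 iz)).
have -> : 1 + zt n.+1 z ^+ 2 = 2 * lam n.+1 z * zt n.+1 z.
  transitivity (zt n.+1 z * (lam n.+1 z + sq (lam n.+1 z)) + zt n.+1 z ^+ 2).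
    by rewrite zE.
  by rewrite /zeta; ring.
rewrite /F !qprodS // ?leqW //.
move: (zt n z) (zt n.+1 z) (q z n) => w0 w1 Q.
have e : n.+1%:Z - 1 = n by rewrite -addn1 PoszD addrK.
rewrite /lam /alpha /beta /kratio e; rewrite e in jac.
move: (orthopoly a b z n) (orthopoly a b z n.+1) (orthopoly a b z n.+2) jac => p0 p1 p2.
rewrite !sqrtrM ?ltW //.
have sE (m : nat) : a m = Num.sqrt (a m) ^+ 2 by rewrite sqr_sqrtr // ltW.
have s0 (m : nat) : (Num.sqrt (a m))%:C != 0.
  by rewrite fmorph_eq0 sqrtr_eq0 -ltNge.
rewrite {1 2}(sE n.+1) {1}(sE n) => jac.
move: (s0 n) (s0 n.+1) (s0 n.+2) jac.
rewrite !(rmorphM, fmorphV, rmorphN, rmorphXn) /= rmorph_nat.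
move: (Num.sqrt (a n.+2))%:C (Num.sqrt (a n.+1))%:C (Num.sqrt (a n))%:C.
move=> A2 A1 A0 h0 h1 h2 jac; move: (_%:C) jac => B jac.
have -> : A1 * A1 / (A0 * A2) * (A2 * (Q * w0 * w1) * p2) =
  (Q * w0 * w1) / A0 * (A1 * A1 * p2) by field; rewrite h0 h2.
have -> : A1 * A1 * p2 = z * p1 - B * p1 - A0 * A0 * p0 by rewrite -jac; ring.
by field; rewrite h0 h1.
Qed.

(** The product q_n occurs in f and in F alike, so after multiplication by zeta_n both Wronskian
    terms are multiples of F_n and F_(n+1), without division by q. Splitting off the increment of F
    leaves F_n with a coefficient tending to zeta^2 - 1. *)
Lemma wronskian_orthopoly (f : C -> int -> C) (e : nat -> C) z n :
  (N0 <= n)%N -> complex.Im z != 0 ->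
  jacobi_solution a b z (f z) ->
  (forall n : nat, f z n = ((Num.sqrt (a n))^-1)%:C * q z n * (1 + e n)) ->
  Omega a b f z * (Num.sqrt (a n.+1 / a n))%:C * zt n z =
  F z n * (zt n z ^+ 2 * (1 + e n.+1) - (1 + e n)) - (F z n.+1 - F z n) * (1 + e n).
Proof.
move=> Nn iz fj fE; have z0 : zt n z != 0.
  have := sqrt_branchK sq_branch (Im_neq0_ncut (Im_spectral_point_neq0 n iz)).
  by apply: contra_eq_neq => ->; rewrite mul0r eq_sym oner_neq0.
rewrite /Omega -(wronskian_const n (orthopoly_jacobi b z a_nat_gt0) fj) /wronskian.
have -> : n%:Z + 1 = n.+1 by rewrite -addn1.
rewrite !fE /F !qprodS //.
have -> : Num.sqrt (a n.+1 / a n) = Num.sqrt (a n.+1) / Num.sqrt (a n).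
  by rewrite sqrtrM ?sqrtrV // ltW.
have sE : a n = Num.sqrt (a n) ^+ 2 by rewrite sqr_sqrtr // ltW.
have s0 (m : nat) : (Num.sqrt (a m))%:C != 0.
  by rewrite fmorph_eq0 sqrtr_eq0 -ltNge.
rewrite {1}sE; move: (s0 n) (s0 n.+1).
rewrite !(rmorphM, fmorphV, rmorphXn) /=.
move: (Num.sqrt (a n))%:C (Num.sqrt (a n.+1))%:C => A0 A1 h0 h1.
by field; rewrite h0 h1.
Qed.

End JacobiAsymptotics.

(** Applied with g the sign of Im z, t = sqrt(1 - beta_inf^2) and w the limit of zeta, for which w^2
    - 1 = -2 i g t w. *)
Lemma signed_quotient (K : numFieldType) (i g t w u : K) : i * i = -1 ->
  g * g = 1 -> i != 0 -> g != 0 -> t != 0 -> w != 0 ->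
  g * (i * u / (2 * t)) = u * w / - (2 * i * (g * t) * w).
Proof.
move=> i2 g2 i0 g0 t0 w0.
transitivity (i * i * (g * g) * u * w / (2 * i * (g * t) * w)).
  by field; rewrite i0 g0 t0 w0.
by rewrite i2 g2 invrN mulr1 !mulN1r mulNr mulrN mulNr.
Qed.

Lemma limit_of_wronskian_identity (K : numFieldType) (F w e x : nat -> K^o)
    (u wi : K) N0 :
  w n @[n --> \oo] --> (wi : K^o) -> e n @[n --> \oo] --> (0 : K^o) ->
  x n @[n --> \oo] --> (1 : K^o) -> (F n.+1 - F n) @[n --> \oo] --> (0 : K^o) ->
  wi ^+ 2 - 1 != 0 ->
  (forall n, (N0 <= n)%N -> u * x n * w n =
    F n * (w n ^+ 2 * (1 + e n.+1) - (1 + e n)) - (F n.+1 - F n) * (1 + e n)) ->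
  F n @[n --> \oo] --> (u * wi / (wi ^+ 2 - 1) : K^o).
Proof.
move=> wcvg e0 xcvg Fdiff den0 rel.
pose D n : K^o := w n ^+ 2 * (1 + e n.+1) - (1 + e n).
have e1 : e n.+1 @[n --> \oo] --> (0 : K^o).
  apply: (cvg_comp S e) e0 => A [N _ hN].
  by exists N => // n Nn; apply: hN; exact: leqW.
have c0 : (1 + e n : K^o) @[n --> \oo] --> (1 + 0 : K^o).
  by apply: cvgD; [exact: cvg_cst|exact: e0].
have c1 : (1 + e n.+1 : K^o) @[n --> \oo] --> (1 + 0 : K^o).
  by apply: cvgD; [exact: cvg_cst|exact: e1].
have Dcvg : D n @[n --> \oo] --> (wi ^+ 2 - 1 : K^o).
  have -> : wi ^+ 2 - 1 = wi * wi * (1 + 0) - (1 + 0) :> K^o by rewrite addr0 mulr1.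
  rewrite /D; under eq_fun do rewrite expr2.
  by apply: cvgB; [apply: cvgM; [exact: cvgM|exact: c1]|exact: c0].
have Gcvg : ((u * x n * w n + (F n.+1 - F n) * (1 + e n)) / D n : K^o)
    @[n --> \oo] --> ((u * 1 * wi + 0 * (1 + 0)) / (wi ^+ 2 - 1) : K^o).
  apply: cvgM; last exact: cvgV.
  apply: cvgD; last exact: cvgM.
  by apply: cvgM; [apply: cvgM; [exact: cvg_cst|exact: xcvg]|exact: wcvg].
rewrite mulr1 mul0r addr0 in Gcvg.
apply: cvg_trans Gcvg; apply: near_eq_cvg.
have Dn : \forall n \near \oo, D n != 0.
  have dgt : 0 < `|wi ^+ 2 - 1| by rewrite normr_gt0.
  have /cvgrPdist_lt/(_ _ dgt) := Dcvg; apply: filterS => n.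
  by apply: contraTneq => ->; rewrite subr0 ltxx.
near=> n; have Nn : (N0 <= n)%N by near: n; exists N0.
rewrite rel // subrK mulfK //; near: n; exact: Dn.
Unshelve. all: by end_near. Qed.

(** * Uniform estimates and the limit on the disc |z| < rho0 *)

Section UniformAsymptotics.
Context {R : realType} (a : int -> R) (b : nat -> R) (beta_inf eps0 rho0 : R).
Local Notation C := R[i].
Variables (sq : C -> C) (N0 : nat).
Hypothesis a_gt0 : forall n : int, -1 <= n -> 0 < a n.
Hypothesis sq_branch : is_sqrt_branch sq.
Hypothesis eps0_gt0 : 0 < eps0.
Hypothesis eps0_lt : eps0 < 1 - `|beta_inf|.
Hypothesis N0_P : forall (n : nat) (z : C), (N0 <= n)%N -> `|z| < rho0%:C ->
  `|(alpha a n)%:C * z + (beta a b n)%:C - beta_inf%:C| < eps0%:C.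

Local Notation lam := (spectral_point a b).
Local Notation zt n z := (zeta sq (lam n z)).
Local Notation F := (weighted_orthopoly a b sq N0).

(** For N0 <= n the points [lam n z] stay in the disc of radius r < 1 about 0, where [kap] bounds
    |Im (sq (lam n z))| from below. *)
Let r : R := `|beta_inf| + eps0.
Let kap : R := Num.sqrt (1 - r ^+ 2).

Let r_gt0 : 0 < r. Proof. by rewrite ltr_wpDl. Qed.
Let r_lt1 : r < 1. Proof. by rewrite /r -ltrBrDl. Qed.
Let kap_gt0 : 0 < kap.
Proof. by rewrite sqrtr_gt0 subr_gt0 expr_lt1 // ltW. Qed.
Let sqr_kap : kap ^+ 2 = 1 - r ^+ 2.
Proof. by rewrite sqr_sqrtr // ltW // subr_gt0 expr_lt1 // ltW. Qed.

Lemma normc_spectral_point n z : (N0 <= n)%N -> normc z < rho0 ->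
  normc (lam n z) <= r.
Proof.
move=> Nn zr; rewrite -[lam n z](subrK beta_inf%:C).
apply: le_trans (le_normcD _ _) _; rewrite addrC normcR lerD2l.
have := N0_P Nn (z := z); rewrite !normcE !ltcR => /(_ zr).
exact: ltW.
Qed.

Lemma Im_sqrt_spectral_point n z : (N0 <= n)%N -> normc z < rho0 ->
  complex.Im z != 0 -> kap <= `|complex.Im (sq (lam n z))|.
Proof.
move=> Nn zr iz; rewrite -(ler_pXn2r (n := 2)) ?nnegrE ?(ltW kap_gt0) //.
rewrite sqr_kap real_normK ?num_real //.
apply: (Im_sqrt_branch_ge sq_branch) => //; last exact: ltW.
  exact: Im_spectral_point_neq0.
exact: normc_spectral_point.
Qed.

Let Im_sqrt_sg n z : complex.Im z != 0 ->
  0 < complex.Im (sq (lam n z)) * complex.Im z.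
Proof.
move=> iz; have := Im_sqrt_branch sq_branch (Im_spectral_point_neq0 b a_gt0 n iz).
by rewrite Im_spectral_point mulrCA pmulr_rgt0 // alpha_gt0.
Qed.

Lemma normc_zetaB n z : (N0 <= n)%N -> normc z < rho0 -> complex.Im z != 0 ->
  normc (zt n.+1 z - zt n z) <= (1 + kap^-1) *
    (rho0 * `|seq_diff (alpha a) n| + `|seq_diff (beta a b) n|).
Proof.
move=> Nn zr iz; have Nn' := leqW Nn.
have le1 m : (N0 <= m)%N -> normc (lam m z) <= 1.
  by move=> Nm; apply: le_trans (normc_spectral_point Nm zr) _; exact: ltW.
have h1 : normc (sq (lam n.+1 z) - sq (lam n z)) * kap <= normc (lam n.+1 z - lam n z).
  apply: (normc_sqrt_branchB sq_branch); rewrite ?le1 //.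
  - exact: Im_spectral_point_neq0.
  - exact: Im_sqrt_spectral_point.
  - exact: Im_sqrt_spectral_point.
  - have i1 := Im_sqrt_sg n.+1 iz; have i0 := Im_sqrt_sg n iz.
    have : 0 < complex.Im z ^+ 2 by rewrite exprn_even_gt0.
    by move=> i2; rewrite -(pmulr_lgt0 _ i2); have := mulr_gt0 i1 i0; nra.
  - case: sq_branch => _ s2 _; apply: s2.
    exact/Im_neq0_ncut/Im_spectral_point_neq0.
have h2 : normc (lam n.+1 z - lam n z) <=
    rho0 * `|seq_diff (alpha a) n| + `|seq_diff (beta a b) n|.
  have -> : lam n.+1 z - lam n z =
      (seq_diff (alpha a) n)%:C * z + (seq_diff (beta a b) n)%:C.
    by rewrite /spectral_point /seq_diff !rmorphB; ring.
  apply: le_trans (le_normcD _ _) _; rewrite normcM !normcR lerD2r mulrC.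
  by rewrite ler_wpM2r // ltW.
have h3 : normc (sq (lam n.+1 z) - sq (lam n z)) <= kap^-1 * normc (lam n.+1 z - lam n z).
  by rewrite ler_pdivlMl // mulrC.
have -> : zt n.+1 z - zt n z = (lam n.+1 z - lam n z) - (sq (lam n.+1 z) - sq (lam n z)).
  by rewrite /zeta; ring.
apply: le_trans (ler_normcB _ _) _.
have k1 : 0 <= 1 + kap^-1 by rewrite addr_ge0 // invr_ge0 ltW.
apply: le_trans (ler_wpM2l k1 h2); rewrite mulrDl mul1r.
by rewrite lerD2l.
Qed.

(** The limit point beta_inf lies on the cut, so continuity of the branch cannot be invoked; the
    root of beta_inf^2 - 1 on the side of z is compared directly with [sq (lam n z)] through
    [normc_sqrt_branchB]. *)
Lemma zeta_spectral_cvg z :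
  (fun n : nat => a n) @ \oo --> +oo ->
  beta a b n @[n --> \oo] --> beta_inf ->
  normc z < rho0 -> complex.Im z != 0 ->
  (zt n z : C^o) @[n --> \oo] --> (Complex beta_inf
     (- (Num.sg (complex.Im z) * Num.sqrt (1 - beta_inf ^+ 2))) : C^o).
Proof.
move=> ainfty bcvg zr iz.
set sg := Num.sg (complex.Im z); set sig := Num.sqrt _.
have b1 : `|beta_inf| <= r by rewrite lerDl ltW.
have b2 : beta_inf ^+ 2 <= r ^+ 2.
  by rewrite -(real_normK (num_real beta_inf)) ler_pXn2r ?nnegrE // ltW.
have r2 : r ^+ 2 < 1 by rewrite expr_lt1 // ltW.
have sig2 : sig ^+ 2 = 1 - beta_inf ^+ 2 by rewrite sqr_sqrtr //; lra.
have sig_ge : kap <= sig by rewrite ler_sqrt; lra.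
have sig0 : 0 < sig by apply: lt_le_trans sig_ge.
have sg1 : `|sg| = 1 by rewrite normr_sg iz.
have sgM : sg * sg = 1 by rewrite -expr2 sqr_sg iz.
have lcvg : (lam n z : C^o) @[n --> \oo] --> (beta_inf%:C : C^o).
  rewrite -[beta_inf%:C]add0r -[X in X + _](mul0r z); apply: cvgD.
    apply: cvgM; last exact: cvg_cst.
    by rewrite -(rmorph0 (real_complex R)); apply: cvg_real_complex; exact: alpha_cvg0.
  exact: cvg_real_complex.
have scvg : (sq (lam n z) : C^o) @[n --> \oo] --> (Complex 0 (sg * sig) : C^o).
  apply/cvg_normcP/cvgrPdist_le => e e0.
  have /cvg_normcP/cvgrPdist_le/(_ _ (mulr_gt0 e0 kap_gt0)) := lcvg.
  apply: filter_app; exists N0 => // n /= Nn.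
  rewrite !sub0r !normrN !ger0_norm ?normc_ge0 // [normc (beta_inf%:C - _)]normc_distrC.
  move=> hn; rewrite normc_distrC -(ler_pM2r kap_gt0); apply: le_trans hn.
  apply: (normc_sqrt_branchB sq_branch) => //.
  - exact: Im_spectral_point_neq0.
  - exact: Im_sqrt_spectral_point.
  - by rewrite /= normrM sg1 mul1r gtr0_norm.
  - rewrite /= mulrA pmulr_lgt0 //; have := Im_sqrt_sg n iz.
    by rewrite [X in _ * X]numEsg mulrA pmulr_lgt0 // normr_gt0.
  - apply/eqP; rewrite !expr2 eq_complex /=; apply/andP; split; apply/eqP; last by ring.
    transitivity (- (sg * sg * sig ^+ 2)); first by ring.
    by rewrite sgM sig2; ring.
  - by apply: le_trans (normc_spectral_point Nn zr) _; exact: ltW.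
  - by rewrite normcR; apply: le_trans b1 _; exact: ltW.
have -> : Complex beta_inf (- (sg * sig)) = beta_inf%:C - Complex 0 (sg * sig).
  by apply/eqP; rewrite eq_complex /= subr0 sub0r !eqxx.
rewrite /zeta; apply: cvgB; [exact: lcvg|exact: scvg].
Qed.

Lemma weighted_orthopoly_uniform_cauchy (delta eta : R) :
  (fun n : nat => a n) @ \oo --> +oo ->
  series (fun n : nat => (a n)^-1) @ \oo --> +oo ->
  0 < delta ->
  bigO_pow (seq_diff (alpha a)) (- 1 - delta) ->
  bigO_pow (seq_diff (beta a b)) (- 1 - delta) ->
  bigO_pow (fun n => kratio a n - 1) (- 1 - delta) ->
  0 < eta ->
  forall e, 0 < e -> exists N, forall z n p,
    normc z < rho0 -> eta <= `|complex.Im z| -> (N <= n)%N -> (N <= p)%N ->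
    normc (F z n - F z p) <= e /\ normc (F z n.+1 - F z n) <= e.
Proof.
move=> ainfty carl d0 aO bO kO eta0 e e0.
have ht := bigO_pow_vanishing_tails d0 aO.
have hb := bigO_pow_vanishing_tails d0 bO.
have hk := bigO_pow_vanishing_tails d0 kO.
pose h1 n := (1 + kap^-1) * (rho0 * `|seq_diff (alpha a) n| + `|seq_diff (beta a b) n|).
pose h n := `|h1 n| + `|kratio a n.+1 - 1|.
have hh : vanishing_tails h.
  apply: vanishing_tailsD; apply: vanishing_tails_norm; last exact: vanishing_tails_shift hk.
  apply/vanishing_tailsZ/vanishing_tailsD; last exact: vanishing_tails_norm.
  exact/vanishing_tailsZ/vanishing_tails_norm.
have h_ge n : `|h n| = h n by rewrite ger0_norm // addr_ge0.
have rat := ratio_cvg1 a_gt0 ainfty carl hk.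
pose D : set C := [set z | normc z < rho0 /\ eta <= `|complex.Im z|].
have Dim z : D z -> complex.Im z != 0.
  by move=> [_ le_eta]; rewrite -normr_gt0; apply: lt_le_trans le_eta.
(* The rate given by [normc_zeta_decay], as Im (lam n.+1 z) = alpha_(n+1) Im z; eta makes it uniform
   in z. *)
pose d n := eta * alpha a n.+1.
have d_ge0 n : 0 <= d n by rewrite mulr_ge0 ?ltW // alpha_gt0.
have ddvg A m : exists N, forall n, (N <= n)%N -> A <= \sum_(m <= j < n) d j.
  have [N hN] := alpha_dvg a_gt0 carl rat (A / eta) m.
  by exists N => n Nn; rewrite -mulr_sumr mulrC -ler_pdivrMr // hN.
have kh n : `|kratio a n.+1 - 1| <= `|h n| by rewrite h_ge lerDr.
have Fb n : exists M, forall z, D z -> normc (F z n) <= M.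
  have [M hM] := weighted_orthopoly_bounded b N0 a_gt0 sq_branch rho0 n.
  by exists M => z Dz; apply: hM (Dim _ Dz); case: Dz => /ltW.
have c0 : 0 < 2 / 3 * kap by rewrite mulr_gt0.
have := @recurrence_uniform_cauchy R C D (fun z n => zt n z) F
  (kratio a) h d (2 / 3 * kap) N0 c0 hh d_ge0 ddvg kh Fb.
move=> /(_ _ e e0)[|N hN]; last by exists N => z n p zr iz; exact: hN.
move=> z n Dz Nn; have iz := Dim z Dz; have [zr eiz] := Dz.
have il m := Im_spectral_point_neq0 b a_gt0 m iz.
have n1 : normc (lam n z) <= 1.
  by apply: le_trans (normc_spectral_point Nn zr) _; exact: ltW.
split.
- exact/ltW/(normc_zeta_lt1 sq_branch).
- apply: le_trans (normc_zeta_decay sq_branch (il n.+1)).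
  rewrite ler_wpM2l ?normc_ge0 // lerD2l Im_spectral_point normrM.
  have al := alpha_gt0 n.+1 a_gt0; rewrite (gtr0_norm al) /d mulrC.
  by rewrite ler_pM2l.
- exact/(normc_sub_sqr_zeta sq_branch (il n) n1)/Im_sqrt_spectral_point.
- rewrite h_ge; apply: le_trans (normc_zetaB Nn zr iz) _.
  by apply: le_trans (ler_norm _) _; rewrite lerDl.
- exact: weighted_orthopoly_rec.
Qed.

Lemma weighted_orthopoly_cvg (f : C -> int -> C) z :
  (fun n : nat => a n) @ \oo --> +oo ->
  beta a b n @[n --> \oo] --> beta_inf ->
  (fun n : nat => a n.+1 / a n) @ \oo --> (1 : R) ->
  normc z < rho0 -> complex.Im z != 0 ->
  jost_solution sq a b N0 z (f z) ->
  (F z n.+1 - F z n : C^o) @[n --> \oo] --> (0 : C^o) ->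
  (F z n : C^o) @[n --> \oo] --> ((Num.sg (complex.Im z))%:C
      * ('i * Omega a b f z / (2 * Num.sqrt (1 - beta_inf ^+ 2))%:C) : C^o).
Proof.
move=> ainfty bcvg rat zr iz [fj [e e0 fE]] Fdiff.
set Om := Omega a b f z; set sg := Num.sg _; set sig := Num.sqrt _.
have sig0 : 0 < sig.
  have b1 : `|beta_inf| < 1 by apply: le_lt_trans r_lt1; rewrite lerDl ltW.
  rewrite sqrtr_gt0 subr_gt0 -(real_normK (num_real beta_inf)).
  by rewrite expr_lt1.
have sgM : sg * sg = 1 by rewrite -expr2 sqr_sg iz.
have sg0 : sg != 0 by rewrite sgr_eq0.
have zcvg := zeta_spectral_cvg ainfty bcvg zr iz.
move: zcvg; rewrite -/sg -/sig; set zi : C := Complex _ _ => zcvg.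
have sig2 : sig ^+ 2 = 1 - beta_inf ^+ 2.
  by rewrite sqr_sqrtr // ltW // -sqrtr_gt0.
have zi0 : zi != 0.
  by rewrite eq_complex /= negb_and oppr_eq0 mulf_neq0 ?orbT // gt_eqF.
(* This is zeta^2 - 1 = -2 s zeta with the boundary value s = i sg sig; zeta then cancels from the
   limit. *)
have ziE : zi ^+ 2 - 1 = - (2 * 'i * (sg * sig)%:C * zi).
  apply/eqP; rewrite !expr2 eq_complex /=; apply/andP; split; apply/eqP; last by ring.
  transitivity (beta_inf ^+ 2 - sg * sg * sig ^+ 2 - 1); first by ring.
  transitivity (- (2 * (sg * sg) * sig ^+ 2)); last by ring.
  by rewrite sgM sig2; ring.
have i0 : 'i != 0 :> C by rewrite eq_complex /= oner_eq0 andbF.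
have ss0 : (sg * sig)%:C != 0 by rewrite fmorph_eq0 mulf_neq0 // gt_eqF.
have den0 : zi ^+ 2 - 1 != 0.
  by rewrite ziE oppr_eq0 !mulf_neq0 // pnatr_eq0.
have -> : sg%:C * ('i * Om / (2 * sig)%:C) = Om * zi / (zi ^+ 2 - 1).
  rewrite ziE !rmorphM rmorph_nat; apply: signed_quotient => //.
  - by rewrite -expr2 sqr_i.
  - by rewrite -rmorphM sgM.
  - by rewrite fmorph_eq0.
  - by rewrite fmorph_eq0 gt_eqF.
have xcvg : ((Num.sqrt (a n.+1 / a n))%:C : C^o) @[n --> \oo] --> (1 : C^o).
  rewrite -(rmorph1 (real_complex R)); apply: cvg_real_complex.
  by rewrite -sqrtr1; apply: continuous_cvg; [exact: sqrt_continuous|exact: rat].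
apply: (limit_of_wronskian_identity (N0 := N0) zcvg e0 xcvg Fdiff den0) => n Nn.
exact: wronskian_orthopoly.
Qed.

End UniformAsymptotics.

(** * Passage to compact sets *)

(** The image of K under Im is compact, hence closed, so a ball about 0 misses it; this covers the
    empty K as well. *)
Lemma compact_Im_bounded_below (R : realType) (K : set R[i]^o) : compact K ->
  K `<=` [set z : R[i] | complex.Im z != 0] ->
  exists2 eta : R, 0 < eta & forall z, K z -> eta <= `|complex.Im z|.
Proof.
move=> Kc Kim.
have Ic : continuous (fun z : R[i]^o => complex.Im (z : R[i])).
  move=> z; have Fz : Filter (nbhs (z : R[i]^o)) by exact: nbhs_filter.
  have zz : (w : R[i]^o) @[w --> (z : R[i]^o)] --> (z : R[i]^o) by exact: cvg_id.
  apply/(cvgrPdist_le (FF := Fz)) => e e0.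
  have /cvgrPdist_le/(_ _ e0) := (cvg_normcP Fz _ _).1 zz.
  apply: filterS => w; rewrite sub0r normrN ger0_norm ?normc_ge0 // => /(le_trans _); apply.
  have -> : complex.Im z - complex.Im w = complex.Im (z - w).
    by move: z w {Fz zz} => [? ?] [? ?].
  exact: normc_ge_Im.
have cK : compact ((fun z : R[i]^o => complex.Im (z : R[i])) @` K).
  apply: continuous_compact => //; exact: continuous_subspaceT.
have nK0 : ~ ((fun z : R[i]^o => complex.Im (z : R[i])) @` K) 0.
  by move=> [z Kz z0]; have := Kim z Kz; rewrite /= z0 eqxx.
have clK := compact_closed (@Rhausdorff R) cK.
have := closed_openC clK; rewrite openE => /(_ 0 nK0).
move=> /nbhs_ballP[eta /= eta0 hB]; exists eta => // z Kz.
rewrite leNgt; apply/negP => zlt; apply: (hB (complex.Im z)); last by exists z.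
by rewrite /ball /= sub0r normrN.
Qed.

Lemma uniform_cvg_of_cauchy (R : realType) (T : choiceType) (K : set T)
    (F : nat -> T -> R[i]^o) (L : T -> R[i]^o) :
  (forall t, K t -> (F n t) @[n --> \oo] --> (L t : R[i]^o)) ->
  (forall e : R, 0 < e -> exists N, forall t n p, K t -> (N <= n)%N -> (N <= p)%N ->
     normc (F n t - F p t) <= e) ->
  {uniform K, F n @[n --> \oo] --> L}.
Proof.
move=> ptw cau A /uniform_nbhs[E [entE sub]].
move: entE; rewrite -entourage_ballE => -[[e1 e2] /= e0 hE].
have [e20 e10] : e2 = 0 /\ 0 < e1.
  by move: e0; rewrite ltcE /= => /andP[/eqP].
(* Passing through an index that depends on t costs at most 2 e1 / 3, strictly below the radius,
   while N does not depend on t. *)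
have [N hN] := cau _ (divr_gt0 e10 (ltr0Sn _ 2)).
exists N => // n /= Nn; apply: sub => t Kt; apply: hE.
rewrite /ball /= normcE e20 ltcR.
have /cvg_normcP/cvgrPdist_le/(_ _ (divr_gt0 e10 (ltr0Sn _ 2)))[M _ hM] := ptw t Kt.
have := hM (maxn M N) (leq_maxl _ _); rewrite sub0r normrN ger0_norm ?normc_ge0 // => h1.
have h2 := hN t (maxn M N) n Kt (leq_maxr _ _) Nn.
have -> : L t - F n t = (L t - F (maxn M N) t) + (F (maxn M N) t - F n t).
  by rewrite addrA subrK.
by apply: le_lt_trans (le_normcD _ _) _; lra.
Qed.

(** The sign of the limit is [Num.sg (complex.Im z)]. Since N0, and with it q, depends on rho0, z is
    restricted to |z| < rho0; rho0 being arbitrary, every compact set off the real axis is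
    reached. *)
Theorem theorem6p11 (R : realType) (a : int -> R) (b : nat -> R)
  (beta_inf delta : R) (sq : R[i] -> R[i])
  (rho0 eps0 : R) (N0 : nat) (f : R[i] -> int -> R[i])
  (a_gt0 : forall n : int, -1 <= n -> 0 < a n)
  (a_cvg : (fun n : nat => a n) @ \oo --> +oo)
  (beta_cvg : beta a b n @[n --> \oo] --> beta_inf)
  (beta_inf_lt1 : `|beta_inf| < 1)
  (carleman : series (fun n : nat => (a n)^-1) @ \oo --> +oo)
  (delta_gt0 : 0 < delta)
  (alpha'_O : bigO_pow (seq_diff (alpha a)) (- 1 - delta))
  (alpha''_O : bigO_pow (seq_diff (seq_diff (alpha a))) (- 2 - delta))
  (beta'_O : bigO_pow (seq_diff (beta a b)) (- 1 - delta))
  (beta''_O : bigO_pow (seq_diff (seq_diff (beta a b))) (- 2 - delta))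
  (k_O : bigO_pow (fun n => kratio a n - 1) (- 1 - delta))
  (k'_O : bigO_pow (seq_diff (kratio a)) (- 2 - delta))
  (sq_branch : is_sqrt_branch sq)
  (rho0_gt0 : 0 < rho0)
  (eps0_gt0 : 0 < eps0) (eps0_lt : eps0 < 1 - `|beta_inf|)
  (N0_ge1 : (1 <= N0)%N)
  (N0_P : forall (n : nat) (z : R[i]), (N0 <= n)%N -> `|z| < rho0%:C ->
     `|(alpha a n)%:C * z + (beta a b n)%:C - beta_inf%:C| < eps0%:C)
  (f_jost : forall z : R[i], `|z| < rho0%:C -> complex.Im z != 0 ->
     jost_solution sq a b N0 z (f z)) :
  let F := fun (n : nat) (z : R[i]) =>
    (Num.sqrt (a n))%:C * qprod sq a b N0 z n * orthopoly a b z n in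
  let L := fun z : R[i] =>
    (Num.sg (complex.Im z))%:C
      * ('i * Omega a b f z / (2 * Num.sqrt (1 - beta_inf ^+ 2))%:C) in
  (forall z : R[i], `|z| < rho0%:C -> complex.Im z != 0 ->
     (F n z : R[i]^o) @[n --> \oo] --> (L z : R[i]^o)) /\
  (forall K : set R[i]^o, compact K ->
     K `<=` [set z : R[i] | `|z| < rho0%:C /\ complex.Im z != 0] ->
     {uniform K, (F n : R[i]^o -> R[i]^o) @[n --> \oo] --> (L : R[i]^o -> R[i]^o)}).
Proof.
move=> F L.
have k_tails := bigO_pow_vanishing_tails delta_gt0 k_O.
have rat := ratio_cvg1 a_gt0 a_cvg carleman k_tails.
have rhoE (z : R[i]) : (`|z| < rho0%:C) = (normc z < rho0) by rewrite normcE ltcR.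
have cauchy := weighted_orthopoly_uniform_cauchy a_gt0 sq_branch eps0_gt0 eps0_lt
  N0_P a_cvg carleman delta_gt0 alpha'_O beta'_O k_O.
have ptw (z : R[i]) : `|z| < rho0%:C -> complex.Im z != 0 ->
    (F n z : R[i]^o) @[n --> \oo] --> (L z : R[i]^o).
  move=> zr iz; have zr' := zr; rewrite rhoE in zr'.
  refine (weighted_orthopoly_cvg (f := f) a_gt0 sq_branch eps0_gt0 eps0_lt N0_P a_cvg beta_cvg
    rat zr' iz (f_jost z zr iz) _).
  apply/cvg_normcP/cvgrPdist_le => e e0.
  (* For a single z, eta = |Im z| serves, and the second half of the Cauchy estimate gives the
     vanishing increments. *)
  have eta0 : 0 < `|complex.Im z| by rewrite normr_gt0.
  have [N hN] := cauchy _ eta0 e e0; exists N => // n Nn.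
  rewrite !sub0r !normrN normcN ger0_norm ?normc_ge0 //.
  by have [] := hN z n n zr' (lexx _) Nn Nn.
split=> // K Kc KD.
have [|eta eta0 Keta] := compact_Im_bounded_below Kc; first by move=> z /KD[].
apply: uniform_cvg_of_cauchy => [z /KD[zr iz]|e e0]; first exact: ptw.
have [N hN] := cauchy _ eta0 e e0; exists N => z n p Kz Nn Np.
have [zr _] := KD z Kz; rewrite rhoE in zr.
by have [] := hN z n p zr (Keta z Kz) Nn Np.
Qed.
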